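(* Let $k,n-k\ge 2$. If all Boolean degree $1$ functions on $C_q(n,k,e)$ and on $J_q(n+1,k)$ are trivial, then all Boolean degree $1$ functions on $C_q(n+1,k,e)$ are trivial.
   Context: $\mathbb{P}_q(n,e)$ denotes a finite classical polar space of rank $n$ over $\mathbb{F}_q$ with parameter $e$, namely $O^+(2n,q)$ ($e=0$), $O(2n+1,q)$ ($e=1$), $O^-(2n+2,q)$ ($e=2$), $Sp(2n,q)$ ($e=1^*$), $U(2n,q)$ ($e=1/2$), $U(2n+1,q)$ ($e=3/2$), considered in its natural ambient vector space over $\mathbb{F}_q$ with polarity $\perp$; its subspaces are the isotropic (totally isotropic/singular) subspaces, and rank $n$ is the maximal dimension of such a subspace. $C_q(n,k,e)$ is the set of isotropic $k$-spaces of $\mathbb{P}_q(n,e)$. Points are isotropic $1$-spaces; hyperplanes are hyperplanes of the ambient space; a hyperplane is degenerate if it equals $p^\perp$ for an isotropic point $p$, and non-degenerate otherwise. For a point $p$, $p^+(K)=1$ iff $p\subseteq K$; for a hyperplane $\pi$, $\pi^+(K)=1$ iff $K\subseteq\pi$; $g^+=g$, $g^-=1-g$. A Boolean degree $1$ function on $C_q(n,k,e)$ is a $\{0,1\}$-valued function $c+\sum_p c_pp^+$ (real constants, sum over points). It is trivial if $f$ or $1-f$ equals $\bigvee_i p_i^+\vee\bigvee_i\pi_i^+\vee\bigvee_i(\tilde\pi_i^+\wedge\tilde p_i^-)$ for points $p_i$ of the polar space, non-degenerate hyperplanes $\pi_i$, and degenerate hyperplanes $\tilde\pi_i=\tilde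 p_i^\perp$. $J_q(N,K)$ is the set of $K$-subspaces of $\mathbb{F}_q^N$; a Boolean degree $1$ function on it (a $\{0,1\}$-valued $c+\sum_pc_pp^+$ over all points of $\mathbb{F}_q^N$) is trivial if it is one of $1^\pm$, $p^\pm$, $\pi^\pm$, $(p^+\vee\pi^+)^\pm$ with $p$ a point, $\pi$ a hyperplane, $p\notin\pi$, where $1^\pm$ are the constants $1,0$. *)

(* Defs.v *)
From HB Require Import structures.
From mathcomp Require Import all_boot all_order all_algebra.
From mathcomp Require Import sesquilinear.
From mathcomp Require Import reals.

Set Implicit Arguments.
Unset Strict Implicit.
Unset Printing Implicit Defensive.

Import GRing.Theory.
Local Open Scope ring_scope.

Section FiniteVspace.
Import VectorInternalTheory.
Variables (F : finFieldType) (V : vectType F).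
HB.instance Definition _ := [Countable of {vspace V} by <:].
HB.instance Definition _ := [Finite of {vspace V} by <:].
End FiniteVspace.

Section Degree1.
Variables (F : finFieldType) (V : vectType F).
Implicit Types (f g : {vspace V} -> bool) (p H K : {vspace V}).
Implicit Types D P : {set {vspace V}}.

(* A Boolean function on a family D of subspaces is a predicate on all         *)
(* subspaces, of which only the restriction to D matters.                      *)

Definition pointf p K : bool := (p <= K)%VS.
Definition hyperf H K : bool := (K <= H)%VS.

Definition boolean_degree1 (R : realType) D P f : Prop :=
  exists (c : R) (cp : {vspace V} -> R),
    {in D, forall K, (f K)%:R = c + \sum_(p in P) cp p * (pointf p K)%:R}.

Definition eq_upto_compl D f g : Prop :=
  {in D, f =1 g} \/ {in D, forall K, f K = ~~ g K}.

Definition all_points : {set {vspace V}} := [set p | \dim p == 1%N].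
Definition hyperplanes : {set {vspace V}} :=
  [set H | (\dim H).+1 == \dim {:V}].

Definition grassmannian (k : nat) : {set {vspace V}} := [set K | \dim K == k].

Definition grassmann_trivial D f : Prop :=
  [\/ eq_upto_compl D f xpredT,
      exists2 p, p \in all_points & eq_upto_compl D f (pointf p),
      exists2 H, H \in hyperplanes & eq_upto_compl D f (hyperf H)
    | exists p H, [/\ p \in all_points, H \in hyperplanes, ~~ (p <= H)%VS
        & eq_upto_compl D f (fun K => pointf p K || hyperf H K)]].

End Degree1.

Definition all_grassmann_trivial (R : realType) (F : finFieldType)
    (N k : nat) : Prop :=
  forall f : {vspace 'rV[F]_N} -> bool,
    boolean_degree1 R (grassmannian _ k) (all_points _) f ->
    grassmann_trivial (grassmannian _ k) f.

Section PolarSpaces.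
Variable F : finFieldType.

(* The form behind a classical polar space. In the orthogonal case B is the    *)
(* polarisation of the quadratic form Q; the polarity always comes from B.     *)
Inductive classical_form (d : nat) : Type :=
| Orthogonal (B : {symmetric 'rV[F]_d}) (Q : 'rV[F]_d -> F)
| Symplectic (B : {skew_symmetric 'rV[F]_d})
| Unitary (theta : {rmorphism F -> F}) (B : {hermitian_sym 'rV[F]_d for theta}).

(* The radical of B may be non-zero when the characteristic is 2 and d is odd; *)
(* nondegeneracy of Q only asks that it contains no singular vector.           *)
Definition nondegenerate_quadratic d (B : {symmetric 'rV[F]_d})
    (Q : 'rV[F]_d -> F) : Prop :=
  [/\ forall a v, Q (a *: v) = a ^+ 2 * Q v,
      forall u v, Q (u + v) = Q u + Q v + B u v
    & forall v, v \in orthov B fullv -> Q v = 0 -> v = 0].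

Variable d : nat.
Local Notation V := 'rV[F]_d.
Implicit Types (phi : classical_form d) (p H K U : {vspace V}).

Definition perp phi U : {vspace V} :=
  match phi with
  | Orthogonal B _ => orthov B U
  | Symplectic B => orthov B U
  | Unitary _ B => orthov B U
  end.

Definition isotropic phi U : bool :=
  (U <= perp phi U)%VS &&
  (if phi is Orthogonal _ Q then [forall u in U, Q u == 0] else true).

Definition polar_rank phi : nat :=
  \max_(U : {vspace V} | isotropic phi U) \dim U.

Definition isotropic_spaces phi (k : nat) : {set {vspace V}} :=
  [set K | isotropic phi K & \dim K == k].

Definition isotropic_points phi := isotropic_spaces phi 1.

Definition degenerate_hyperplane phi H : bool :=
  (H \in hyperplanes V) && [exists p in isotropic_points phi, H == perp phi p].

Definition nondegenerate_hyperplane phi H : bool :=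
  (H \in hyperplanes V) && ~~ degenerate_hyperplane phi H.

(* S is the set of the p_i, N that of the pi_i, and T that of the points       *)
(* tilde p_i, which carry the degenerate hyperplanes tilde p_i^perp.           *)
Definition polar_trivial phi (D : {set {vspace V}}) (f : {vspace V} -> bool) :
    Prop :=
  exists S N T : {set {vspace V}},
    [/\ S \subset isotropic_points phi,
        {in N, forall H, nondegenerate_hyperplane phi H},
        T \subset isotropic_points phi
      & eq_upto_compl D f (fun K =>
          [|| [exists p in S, pointf p K],
              [exists H in N, hyperf H K]
            | [exists p in T, hyperf (perp phi p) K && ~~ pointf p K]])].

End PolarSpaces.

Inductive polar_type : Type :=
| OPlus       (* O^+(2n, q),   e = 0   *)
| OParabolic  (* O(2n+1, q),   e = 1   *)
| OMinus      (* O^-(2n+2, q), e = 2   *)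
| Sp          (* Sp(2n, q),    e = 1^* *)
| UEven       (* U(2n, q),     e = 1/2 *)
| UOdd.       (* U(2n+1, q),   e = 3/2 *)

Definition ambient_dim (e : polar_type) (n : nat) : nat :=
  match e with
  | OPlus | Sp | UEven => n.*2
  | OParabolic | UOdd => n.*2.+1
  | OMinus => n.*2.+2
  end.

Definition form_of_type (F : finFieldType) d (e : polar_type)
    (phi : classical_form F d) : Prop :=
  match e, phi with
  | (OPlus | OParabolic | OMinus), Orthogonal B Q =>
      nondegenerate_quadratic B Q
  | Sp, Symplectic B => is_psymplectic B
  | (UEven | UOdd), Unitary theta B =>
      [/\ involutive theta, ~ theta =1 id & is_unitary B]
  | _, _ => False
  end.

(* phi defines a polar space P_q(n, e): its Witt index is n, which is what     *)
(* separates the three orthogonal types.                                       *)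
Definition is_polar_space (F : finFieldType) (e : polar_type) (n : nat)
    (phi : classical_form F (ambient_dim e n)) : Prop :=
  form_of_type e phi /\ polar_rank phi = n.

(* P_q(n, e) is determined by q, n and e up to isomorphism only, so this       *)
(* quantifies over all its models.                                             *)
Definition all_polar_trivial (R : realType) (F : finFieldType)
    (e : polar_type) (n k : nat) : Prop :=
  forall phi : classical_form F (ambient_dim e n),
    is_polar_space phi ->
    forall f : {vspace 'rV[F]_(ambient_dim e n)} -> bool,
      boolean_degree1 R (isotropic_spaces phi k) (isotropic_points phi) f ->
      polar_trivial phi (isotropic_spaces phi k) f.

(* Main.v *)
(* A Boolean degree 1 function f is a sum of point weights. On a generator M, that
   is, a maximal isotropic space, f is trivial by the hypothesis on J_q(n+1,k), and
   as the weights on M are determined by the values on its k-spaces, they are known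
   explicitly. The weights occurring for 0, p^+, pi^- and (p^+ \/ pi^+)^- are
   disjoint from those of the complements, hence, collinear points sharing a
   generator, one may assume that all generators are of these four types, the weight
   of a vector being one of 0, o, t, t - o, where o = 1 / (q - 1) and t = 1 / (q^k -
   q^(k-1)). If t - o does not occur, then f is the disjunction of the points of
   nonzero weight. Otherwise fix a point p of weight t - o; the points of weight 0 or
   o meet every line in one or all points. For a hyperbolic pair a, b orthogonal to
   p, the hypothesis on C_q(n,k,e), applied to {a,b}^perp, shows that these points
   form a hyperplane there. Choosing a, b of weight 0 or o, this hyperplane together
   with a and b spans a hyperplane H of the whole space, which carries all points of
   weight 0 or o; so 1 - f is the disjunction of the points of weight t - o and of H,
   except that if there is a point of weight o, then it is unique, H is its perp, and
   H^+ is replaced by its conjunction with the negated point. *)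

Require Import Defs.
From HB Require Import structures.
From mathcomp Require Import all_boot all_order all_algebra finfield reals.
From mathcomp Require Import sesquilinear.
From mathcomp Require Import zify ring lra.

Set Implicit Arguments.
Unset Strict Implicit.
Unset Printing Implicit Defensive.

Import Order.TTheory GRing.Theory Num.Theory.
Local Open Scope ring_scope.

(** * Linear algebra *)

Section Subspaces.
Variables (F : fieldType) (V : vectType F).
Implicit Types (A C K U : {vspace V}) (x y v : V).

(** A vector space is not the union of two proper subspaces. *)
Lemma exists_notin2 A U C :
  ~~ (A <= U)%VS -> ~~ (A <= C)%VS -> exists v, [/\ v \in A, v \notin U & v \notin C].
Proof.
move=> /subvPn[x xA xU] /subvPn[y yA yC].
have [xC|xC] := boolP (x \in C); last by exists x.
have [yU|yU] := boolP (y \in U); last by exists y.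
by exists (x + y); split; rewrite ?(rpredD xA yA) ?(rpredDr _ yU) ?(rpredDl _ xC).
Qed.

Lemma dim_add_line U v : (\dim (U + <[v]>) <= (\dim U).+1)%N.
Proof.
rewrite (leq_trans (dimv_add_leqif _ _).1) // dim_vline -addn1 leq_add2l.
by case: (v != 0).
Qed.

Lemma dim_add_lines x y : (\dim (<[x]> + <[y]>) <= 2)%N.
Proof. by rewrite (leq_trans (dim_add_line _ _)) // ltnS dim_vline leq_b1. Qed.

Lemma dim_add_line_notin U v : v \notin U -> \dim (U + <[v]>) = (\dim U).+1.
Proof.
move=> vU; rewrite dimv_disjoint_sum; last first.
  apply/eqP; rewrite -subv0; apply/subvP => x /memv_capP[xU /vlineP[c xE]].
  move: xU; rewrite xE; have [->|c0] := eqVneq c 0; first by rewrite scale0r memv0.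
  by move=> /(memvZ c^-1); rewrite scalerA mulVf // scale1r (negbTE vU).
have v0 : v != 0 by apply: contraNneq vU => ->; rewrite mem0v.
by rewrite dim_vline v0 addn1.
Qed.
(** [C] is enlarged one vector [v] at a time. While its dimension is below [k], both [C + <[y1]>]
    and [C + <[y2]>] miss part of [A], so [v] can be taken outside both. The conditions
    [y \in C -> y = 0] let a zero vector stand for nothing to avoid. *)
Lemma exists_subspace_avoiding A C k y1 y2 :
    (C <= A)%VS -> (\dim C <= k < \dim A)%N ->
    (y1 \in C -> y1 = 0) -> (y2 \in C -> y2 = 0) ->
  exists K, [/\ (C <= K)%VS, (K <= A)%VS, \dim K = k, y1 \in K -> y1 = 0
    & y2 \in K -> y2 = 0].
Proof.
move=> + /andP[+ kA]; move: {2}(k - \dim C)%N (erefl (k - \dim C)%N) => m.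
elim: m C => [|m IHm] C mE CA Ck y1C y2C.
  by exists C; split=> //; apply/eqP; rewrite eqn_leq Ck -subn_eq0 mE.
have Ck1 : (\dim C < k)%N by rewrite -subn_gt0 mE.
have notsub y : ~~ (A <= C + <[y]>)%VS.
  apply: contraL (dim_add_line C y) => /dimvS; rewrite -ltnNge.
  by apply: leq_trans; rewrite (leq_trans _ kA).
have [v [vA vy1 vy2]] := exists_notin2 (notsub y1) (notsub y2).
(* If [y] entered through a nonzero multiple of [v], then [v] would lie in [C + <[y]>]. *)
have step y : v \notin (C + <[y]>)%VS -> (y \in C -> y = 0) ->
    y \in (C + <[v]>)%VS -> y = 0.
  move=> vy yC /memv_addP[c cC [_ /vlineP[a ->] yE]].
  have [a0|a0] := eqVneq a 0; first by apply: yC; rewrite yE a0 scale0r addr0.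
  case/negP: vy; have -> : v = - a^-1 *: c + a^-1 *: y.
    by rewrite yE scalerDr scalerA mulVf // scaleNr addKr scale1r.
  by rewrite memv_add ?memvZ ?cC ?memv_line ?orbT.
have vC : v \notin C.
  by apply: contra vy1 => vC; rewrite (subvP (addvSl _ _)).
have [|||||K [CK KA dK y1K y2K]] := IHm (C + <[v]>)%VS.
- by rewrite dim_add_line_notin // subnS mE.
- by rewrite subv_add CA -memvE.
- by rewrite dim_add_line_notin.
- exact: step.
- exact: step.
- by exists K; split=> //; rewrite (subv_trans (addvSl _ _) CK).
Qed.

Lemma exists_subspace_between A C k :
  (C <= A)%VS -> (\dim C <= k <= \dim A)%N ->
  exists K, [/\ (C <= K)%VS, (K <= A)%VS & \dim K = k].
Proof.
move=> CA /andP[Ck]; rewrite leq_eqVlt => /predU1P[->|kA]; first by exists A.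
have [|//|//|K [? ? ? _ _]] := @exists_subspace_avoiding A C k 0 0 CA.
  by rewrite Ck.
by exists K.
Qed.

Lemma dim_cap_codim1 A B M : (A <= M)%VS -> (B <= M)%VS -> (\dim M <= (\dim B).+1)%N ->
  (\dim A <= (\dim (A :&: B)).+1)%N.
Proof.
move=> AM BM dB; rewrite -(leq_add2r (\dim B)) -dimv_sum_cap.
rewrite addSnnS [X in (_ <= X)%N]addnC leq_add2r (leq_trans _ dB) // dimvS //.
by rewrite subv_add AM.
Qed.

End Subspaces.

Lemma card_vspace_rV (F : finFieldType) d (U : {vspace 'rV[F]_d}) :
  #|[pred v | v \in U]| = (#|F| ^ \dim U)%N.
Proof. exact: card_vspace. Qed.

(** * Sums of weights over subspaces *)

Lemma bool_natr_inj (R : numDomainType) (b c : bool) : b%:R = c%:R :> R -> b = c.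
Proof. by move=> /eqP; rewrite eqr_nat; case: b; case: c. Qed.

Section SubspaceSums.
Variables (R : realFieldType) (F : finFieldType) (d : nat).
Local Notation V := 'rV[F]_d.
Local Notation q := (#|F|%:R : R).
Implicit Types (A B C D K U M p : {vspace V}) (h w : V -> R) (v x y : V).

(** Weights sit on vectors rather than points, so that sums split along partitions of vectors; for a
    homogeneous weight vanishing at 0, a point contributes [q - 1] times the value on its nonzero
    vectors. *)
Definition vsum w U : R := \sum_(v | v \in U) w v.

Lemma vsum_sub w C A : (C <= A)%VS ->
  \sum_(v | (v \in A) && (v \notin C)) w v = vsum w A - vsum w C.
Proof.
move=> /subvP CA; rewrite /vsum [in RHS](bigID (fun v => v \in C)) /=.
rewrite [X in _ = X + _ - _](_ : _ = vsum w C) ?[vsum w C + _]addrC ?addrK //.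
by apply: eq_bigl => v; rewrite andb_idl // => /CA.
Qed.

Lemma vsum1 U : vsum (fun=> 1) U = q ^+ \dim U.
Proof. by rewrite /vsum sumr_const card_vspace_rV natrX. Qed.

Lemma q_gt1 : 1 < q.
Proof. by rewrite ltr1n finNzRing_gt1. Qed.

(* The spaces between C and D partition the complement of C in D. *)
Lemma vsum_extensions w C D s :
    (C <= D)%VS -> \dim D = (\dim C).+2 ->
    (forall A, (C <= A)%VS -> (A <= D)%VS -> \dim A = (\dim C).+1 ->
       vsum w A = s) ->
  vsum w C = (s * (q + 1) - vsum w D) / q.
Proof.
move=> CD dD sA.
pose mid A := [&& (C <= A)%VS, (A <= D)%VS & \dim A == (\dim C).+1].
have part h : vsum h D - vsum h C = \sum_(A | mid A) (vsum h A - vsum h C).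
  rewrite -vsum_sub // (partition_big (fun v => C + <[v]>)%VS mid) /=; last first.
    move=> v /andP[vD vC]; rewrite /mid addvSl subv_add CD -memvE vD.
    by rewrite dim_add_line_notin /=.
  apply: eq_bigr => A /and3P[CA AD /eqP dA]; rewrite -vsum_sub //.
  apply: eq_bigl => v; have [vC|vC] := boolP (v \in C); first by rewrite !andbF.
  rewrite !andbT; apply/andP/idP => [[_ /eqP <-]|vA].
    by rewrite (subvP (addvSr _ _)) ?memv_line.
  rewrite (subvP AD) //; split=> //.
  by rewrite eqEdim subv_add CA -memvE vA dA dim_add_line_notin /=.
have q1 := q_gt1; have q0 : q != 0 by rewrite gt_eqF // (lt_trans ltr01).
(* The identity [part], applied to the constant weight 1, counts the intermediate spaces. *)
have mE : \sum_(A | mid A) (1 : R) = q + 1.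
  have qj0 : q ^+ \dim C != 0 by rewrite expf_neq0.
  have qm0 : q - 1 != 0 by rewrite subr_eq0 gt_eqF.
  apply: (mulIf (mulf_neq0 qj0 qm0)).
  have := part (fun=> 1); rewrite !vsum1 dD.
  rewrite (eq_bigr (fun=> 1 * (q ^+ \dim C * (q - 1)))); last first.
    by move=> A /and3P[_ _ /eqP dA]; rewrite vsum1 dA exprS; ring.
  by rewrite -mulr_suml => <-; rewrite !exprS; ring.
have := part w; rewrite (eq_bigr (fun=> 1 * (s - vsum w C))); last first.
  by move=> A /and3P[CA AD /eqP dA]; rewrite sA // mul1r.
rewrite -mulr_suml mE => E; apply: (mulIf q0); rewrite divfK //.
by move: E; lra.
Qed.

(** Induction on the codimension [i] in [B]: codimension 0 is [B] alone, codimension 1 is the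
    hypothesis, and beyond that [vsum_extensions] expresses the sum by those over spaces one and two
    dimensions larger. *)
Lemma vsum_constant w B k : \dim B = k.+1 ->
    (forall K, (K <= B)%VS -> \dim K = k -> vsum w K = 0) ->
  forall i, exists s, forall C, (C <= B)%VS -> (\dim C + i)%N = k.+1 ->
    vsum w C = s.
Proof.
move=> dB w0 i; elim/ltn_ind: i => -[|[|i]] IHi.
- exists (vsum w B) => C CB; rewrite addn0 => dC; congr vsum.
  by apply/eqP; rewrite eqEdim CB dB dC leqnn.
- by exists 0 => C CB /eqP; rewrite addn1 eqSS => /eqP; apply: w0.
have [|s0 s0E] := IHi i; first by lia.
have [|s1 s1E] := IHi i.+1; first by lia.
exists ((s1 * (q + 1) - s0) / q) => C CB dC.
have [||D [CD DB dD]] := @exists_subspace_between _ _ B C (\dim C).+2; rewrite ?dB //.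
  by lia.
rewrite (@vsum_extensions w C D s1) //; first by rewrite (s0E D) // dD; lia.
by move=> A CA AD dA; rewrite s1E ?(subv_trans AD DB) // dA; lia.
Qed.

Lemma vsum0 w : vsum w 0 = w 0.
Proof. by rewrite /vsum (big_pred1 0) // => v; rewrite memv0. Qed.

Lemma vsum_const w C A c : (C <= A)%VS ->
    (forall v, v \in A -> v \notin C -> w v = c) ->
  vsum w A - vsum w C = c * (q ^+ \dim A - q ^+ \dim C).
Proof.
move=> CA wc; rewrite -vsum_sub // -!vsum1 -vsum_sub // mulr_sumr.
by apply: eq_bigr => v /andP[vA vC]; rewrite mulr1 wc.
Qed.

Lemma dim_line x : x != 0 -> \dim <[x]> = 1%N.
Proof. by rewrite dim_vline => ->. Qed.

Lemma vsum_line w x : w 0 = 0 -> (forall a v, a != 0 -> w (a *: v) = w v) ->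
  vsum w <[x]> = (q - 1) * w x.
Proof.
move=> w0 wZ; have [->|x0] := eqVneq x 0.
  have -> : <[0 : V]>%VS = 0%VS by apply/eqP; rewrite -subv0 -memvE mem0v.
  by rewrite vsum0 w0 mulr0.
have := @vsum_const w 0%VS <[x]> (w x) (sub0v _).
rewrite vsum0 w0 subr0 (dim_line x0) dimv0 expr0 expr1 mulrC => -> //.
move=> v /vlineP[c ->]; rewrite memv0 scaler_eq0 (negbTE x0) orbF.
by move/wZ.
Qed.

(** In a (k+1)-space [B] through [x], [vsum_constant] in codimension [k] shows that all points have
    the same weight. The sum over one k-space of [B] is a nonzero multiple of it, so it is 0. *)
Lemma vsum_inj w M k : w 0 = 0 -> (forall a v, a != 0 -> w (a *: v) = w v) ->
    (0 < k < \dim M)%N ->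
    (forall K, (K <= M)%VS -> \dim K = k -> vsum w K = 0) ->
  {in M, forall v, w v = 0}.
Proof.
move=> w0 wZ /andP[k0 kM] wK x xM; have [->//|x0] := eqVneq x 0.
have [||B [xB BM dB]] := @exists_subspace_between _ _ M <[x]> k.+1.
- by rewrite -memvE.
- by rewrite dim_line.
have [K KB dK|s sE] := @vsum_constant w B k dB _ k.
  by rewrite wK // (subv_trans KB BM).
have q1 := q_gt1; have qm0 : q - 1 != 0 by rewrite subr_eq0 gt_eqF.
have wc v : v \in B -> v \notin 0%VS -> w v = s / (q - 1).
  move=> vB; rewrite memv0 => v0; rewrite -(sE <[v]>%VS) -?memvE //.
    by rewrite vsum_line // mulrC mulKf.
  by rewrite dim_line.
have [||K [_ KB dK]] := @exists_subspace_between _ _ B 0%VS k.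
- exact: sub0v.
- by rewrite dimv0 dB /=.
have := @vsum_const w 0%VS K (s / (q - 1)) (sub0v _) (fun v vK => wc v (subvP KB v vK)).
rewrite wK ?(subv_trans KB BM) // vsum0 w0 subrr dK dimv0 => /esym/eqP.
rewrite mulf_eq0 [X in _ || X]gt_eqF ?subr_gt0 ?exprn_egt1 -?lt0n // orbF => /eqP c0.
by rewrite wc ?c0 ?memv0 // memvE.
Qed.

End SubspaceSums.

(** * Degree 1 functions as sums of vector weights *)

Section Weights.
Variables (R : realType) (F : finFieldType) (d : nat).
Local Notation V := 'rV[F]_d.
Local Notation q := (#|F|%:R : R).
Implicit Types (K p : {vspace V}) (w : V -> R) (D P : {set {vspace V}}) (f : {vspace V} -> bool).

Lemma vsum_points w K : w 0 = 0 ->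
  vsum w K = \sum_(p in all_points V) vsum w p * (p <= K)%VS%:R.
Proof.
move=> w0; have := @vsum_sub _ _ _ w 0%VS K (sub0v _).
rewrite vsum0 w0 subr0 => <-.
rewrite (partition_big (fun v => <[v]>%VS) (mem (all_points V))) /=; last first.
  by move=> v /andP[_]; rewrite memv0 inE => /dim_line ->.
apply: eq_bigr => p; rewrite inE => /eqP dp.
have [pK|pK] := boolP (p <= K)%VS; rewrite ?mulr1 ?mulr0.
  have <- : vsum w p - vsum w 0%VS = vsum w p by rewrite vsum0 w0 subr0.
  rewrite -vsum_sub ?sub0v //; apply: eq_bigl => v.
  rewrite memv0; have [->|v0] := eqVneq v 0; first by rewrite !andbF.
  rewrite !andbT; apply/andP/idP => [[_ /eqP <-]|vp]; first by rewrite memv_line.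
  by rewrite (subvP pK) //; split=> //; rewrite eqEdim -memvE vp dp dim_line.
rewrite big_pred0 // => v; apply/negbTE; apply: contra pK => /andP[/andP[vK _]].
by move=> /eqP <-; rewrite -memvE.
Qed.

(** The constant [c] is spread evenly over the [q ^+ k - 1] nonzero vectors of a k-space, and the
    coefficient of a point over its [q - 1] nonzero vectors. *)
Lemma degree1_weights D P f k : (0 < k)%N ->
    {in D, forall K, \dim K = k} ->
    {in P, forall p, \dim p = 1%N} ->
    {in D, forall K p, \dim p = 1%N -> (p <= K)%VS -> p \in P} ->
    boolean_degree1 R D P f ->
  exists w, [/\ w 0 = 0, forall a v, a != 0 -> w (a *: v) = w v
    & {in D, forall K, (f K)%:R = vsum w K}].
Proof.
move=> k0 Dk P1 DP [c [cp fE]].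
have q1 := q_gt1 R F; have qm0 : q - 1 != 0 by rewrite subr_eq0 gt_eqF.
have qk0 : q ^+ k - 1 != 0 by rewrite subr_eq0 gt_eqF // exprn_egt1 // -lt0n.
pose w1 (v : V) : R := (v != 0)%:R; pose w2 (v : V) : R := (v != 0)%:R * cp <[v]>%VS.
have w1s K : vsum w1 K = q ^+ \dim K - 1.
  have := @vsum_const _ _ _ w1 0%VS K 1 (sub0v _).
  rewrite vsum0 /w1 eqxx subr0 dimv0 mul1r => -> // v _.
  by rewrite memv0 => ->.
have w2s p : \dim p = 1%N -> vsum w2 p = cp p * (q - 1).
  move=> dp; have := @vsum_const _ _ _ w2 0%VS p (cp p) (sub0v _).
  rewrite vsum0 /w2 eqxx mul0r subr0 dimv0 dp => -> // v vp.
  rewrite memv0 => v0; rewrite v0 mul1r; congr cp.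
  by apply/eqP; rewrite eqEdim -memvE vp dp dim_line.
exists (fun v => w1 v * (c / (q ^+ k - 1)) + w2 v / (q - 1)); split.
- by rewrite /w1 /w2 eqxx !mul0r addr0.
- move=> a v a0; rewrite /w1 /w2 scaler_eq0 (negbTE a0) /=.
  have [->|v0] := eqVneq v 0; first by rewrite !mul0r.
  rewrite !mul1r; congr (_ + cp _ / _); apply/eqP.
  by rewrite eqEdim -memvE memvZ ?memv_line // !dim_line // scaler_eq0 negb_or a0.
move=> K KD; rewrite /vsum big_split /= -!mulr_suml -[X in _ = X * _ + _]/(vsum w1 K).
rewrite -[X in _ = _ + X / _]/(vsum w2 K) w1s (Dk _ KD) mulrC divfK //.
rewrite fE // vsum_points /w2 ?eqxx ?mul0r //; congr (_ + _).
(* Points outside [P] lie in no member of [D], so the values of [cp] there do not enter. *)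
rewrite mulr_suml [RHS](bigID (fun p => p \in P)) /= [RHS]addrC.
rewrite [X in _ = X + _]big1 ?add0r; last first.
  move=> p /andP[pP pNP]; have [pK|] := boolP (p <= K)%VS; last by rewrite mulr0 mul0r.
  by case/negP: pNP; apply: (DP _ KD) => //; move: pP; rewrite inE => /eqP.
apply: eq_big => p; last first.
  by move=> pP; rewrite -/w2 w2s ?P1 // /pointf mulrAC mulfK.
by rewrite inE andb_idl // => /P1 ->.
Qed.

Lemma weights_degree1 D P f w : w 0 = 0 ->
    {in P, forall p, \dim p = 1%N} ->
    {in D, forall K p, \dim p = 1%N -> (p <= K)%VS -> p \in P} ->
    {in D, forall K, (f K)%:R = vsum w K} ->
  boolean_degree1 R D P f.
Proof.
move=> w0 P1 DP fE; exists 0, (vsum w) => K KD; rewrite add0r fE // vsum_points //.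
rewrite [LHS](bigID (fun p => p \in P)) /= addrC big1 ?add0r; last first.
  move=> p /andP[pP pNP]; have [pK|] := boolP (p <= K)%VS; last by rewrite mulr0.
  by case/negP: pNP; apply: (DP _ KD) => //; move: pP; rewrite inE => /eqP.
by apply: eq_bigl => p; rewrite inE andb_idl // => /P1 ->.
Qed.

End Weights.

(** * Weights of the trivial functions on a generator *)

Section ZeroType.
Variables (R : realFieldType) (F : finFieldType) (d : nat) (k : nat).
Hypothesis k_gt0 : (0 < k)%N.
Local Notation V := 'rV[F]_d.
Local Notation q := (#|F|%:R : R).
Implicit Types (K U M : {vspace V}) (w : V -> R) (p v : V).
Implicit Types f : {vspace V} -> bool.

(* The inverses of the numbers of nonzero vectors of a point, of vectors of a k-space
   outside a hyperplane of it, and of nonzero vectors of a k-space. *)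
Definition wpoint : R := (q - 1)^-1.
Definition waffine : R := (q ^+ k - q ^+ k.-1)^-1.
Definition wunit : R := (q ^+ k - 1)^-1.

(** The zero vector encodes an absent point, through which no space passes. *)
Definition through p K := (p != 0) && (p \in K).

Definition point_weight p v : R := (through v <[p]>)%:R * wpoint.
(** For [p = 0] the correction is supported at [v = 0], which lies in [U], so it disappears. *)
Definition affine_weight U p v : R :=
  (v \notin U)%:R * (waffine - (v \in <[p]>%VS)%:R * wpoint).

(* The weights of 0 and p^+ in the first case, of pi^- and (p^+ \/ pi^+)^- in the
   second one. Here p = 0 means that there is no p, and U and p need not lie in M, so
   that the notion passes to subspaces of M. *)
Definition zero_type w M : Prop :=
  (exists p, {in M, w =1 point_weight p}) \/
  (exists U p, [/\ p \in U -> p = 0, (\dim M <= (\dim (M :&: U)).+1)%N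
                 & {in M, w =1 affine_weight U p}]).

(** The functions 0 and p^+, respectively pi^- and (p^+ \/ pi^+)^-, on the k-spaces of [M]; their
    weights are those of [zero_type]. *)
Definition zero_shape f M : Prop :=
  (exists p, forall K, (K <= M)%VS -> \dim K = k -> f K = through p K) \/
  (exists U p, [/\ p \in U -> p = 0, (\dim M <= (\dim (M :&: U)).+1)%N
     & forall K, (K <= M)%VS -> \dim K = k ->
         f K = ~~ (K <= U)%VS && ~~ through p K]).

Lemma wpoint_neq0 : q - 1 != 0.
Proof. by rewrite subr_eq0 gt_eqF // q_gt1. Qed.

Lemma eq_vsum w1 w2 K : {in K, w1 =1 w2} -> vsum w1 K = vsum w2 K.
Proof. exact: eq_bigr. Qed.

Lemma zero_typeS w M M' : (M' <= M)%VS -> zero_type w M -> zero_type w M'.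
Proof.
move=> M'M [[p wE]|[U [p [pU dM wE]]]]; [left | right].
  by exists p => v /(subvP M'M)/wE.
exists U, p; split=> // [|v /(subvP M'M)/wE //].
have := dimv_sum_cap M' (M :&: U); rewrite capvA (capv_idPl M'M).
have : (\dim (M' + M :&: U) <= \dim M)%N by rewrite dimvS // subv_add M'M capvSl.
lia.
Qed.

Lemma memvZ_neq0 a U v : a != 0 -> (a *: v \in U) = (v \in U).
Proof.
by move=> a0; apply/idP/idP => [/(memvZ a^-1)|/memvZ//]; rewrite scalerK.
Qed.

Lemma vline_sym x p : x != 0 -> x \in <[p]>%VS -> p \in <[x]>%VS.
Proof.
move=> x0 /vlineP[a xE]; rewrite xE in x0 *.
have a0 : a != 0 by apply: contraNneq x0 => ->; rewrite scale0r.
by rewrite -[X in X \in _](scalerK a0) memvZ ?memv_line.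
Qed.

Lemma point_weightZ p a v : a != 0 -> point_weight p (a *: v) = point_weight p v.
Proof.
by move=> a0; rewrite /point_weight /through memvZ_neq0 // scaler_eq0 (negbTE a0).
Qed.

Lemma affine_weightZ U p a v : a != 0 ->
  affine_weight U p (a *: v) = affine_weight U p v.
Proof. by move=> a0; rewrite /affine_weight !memvZ_neq0. Qed.

Lemma vsum_point_weight p K : vsum (point_weight p) K = (through p K)%:R.
Proof.
rewrite /through; case: (eqVneq p 0) => [p0|p0] /=.
  apply: big1 => v _; rewrite /point_weight /through p0.
  case: eqVneq => [_|v0] /=; first by rewrite mul0r.
  by case: vlineP v0 => [[a ->]|]; rewrite ?scaler0 ?eqxx // mul0r.
have [pK|pK] := boolP (p \in K); last first.
  apply: big1 => v vK; rewrite /point_weight /through.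
  case: eqVneq => [_|v0] /=; first by rewrite mul0r.
  case: (boolP (_ \in _)) => [vp|]; last by rewrite mul0r.
  by case/negP: pK; have := vline_sym v0 vp; apply/subvP; rewrite -memvE.
rewrite /vsum (bigID (fun v => v \in <[p]>%VS)) /= addrC big1 ?add0r; last first.
  by move=> v /andP[_ /negbTE vp]; rewrite /point_weight /through vp andbF mul0r.
rewrite (eq_bigl (fun v => v \in <[p]>%VS)); last first.
  by move=> v; rewrite andb_idl //; apply/subvP; rewrite -memvE.
rewrite -/(vsum _ _) vsum_line; first last.
- by move=> a v; apply: point_weightZ.
- by rewrite /point_weight /through eqxx mul0r.
by rewrite /point_weight /through p0 memv_line mul1r divff // wpoint_neq0.
Qed.

(** As [p] is not in [U] unless it is 0, a space through [p] is never inside [U], so the conjunction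
    is a difference of indicators. The second one is the sum of [point_weight]; the first one counts
    the vectors of [K] outside [U]. *)
Lemma vsum_affine_weight U p M K : (p \in U -> p = 0) ->
    (\dim M <= (\dim (M :&: U)).+1)%N -> (K <= M)%VS -> \dim K = k ->
  vsum (affine_weight U p) K = (~~ (K <= U)%VS && ~~ through p K)%:R.
Proof.
move=> pU dM KM dK.
have q1 := q_gt1 R F.
rewrite (_ : (_ && _)%:R = (~~ (K <= U)%VS)%:R - (through p K)%:R :> R); last first.
  rewrite /through; case: eqP => p0 /=; first by rewrite andbT subr0.
  have [pK|pK] := boolP (p \in K); last by rewrite andbT subr0.
  have -> : (K <= U)%VS = false by apply/negP => /subvP/(_ p pK)/pU/p0.
  by rewrite /= subrr.
rewrite -vsum_point_weight.
pose h v : R := (v \notin U)%:R * waffine.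
rewrite (@eq_vsum _ (fun v => h v - point_weight p v)); last first.
  move=> v _; rewrite /h /affine_weight /point_weight mulrBr mulrA; congr (_ - _ * _).
  rewrite -natrM mulnb; congr (nat_of_bool _)%:R; rewrite /through.
  apply: andb_id2r => vp; congr (~~ _); apply/idP/eqP => [vU|->]; last exact: mem0v.
  apply: contraTeq vU => v0; have /vlineP[a pE] := vline_sym v0 vp.
  apply: contra v0 => vU.
  by move: vp; rewrite (pU _) ?pE ?memvZ // => /vlineP[b ->]; rewrite scaler0.
rewrite /vsum sumrB; congr (_ - _).
have hs : \sum_(v in K) h v = waffine * (q ^+ k - q ^+ \dim (K :&: U)).
  have h0 : vsum h (K :&: U) = 0.
    by apply: big1 => v; rewrite memv_cap /h => /andP[_ ->]; rewrite mul0r.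
  rewrite -dK -(@vsum_const _ _ _ h (K :&: U)%VS K waffine (capvSl _ _)).
    by rewrite h0 subr0.
  by move=> v vK; rewrite memv_cap vK /h => ->; rewrite mul1r.
rewrite hs; have [KU|KU] := boolP (K <= U)%VS.
  by rewrite (capv_idPl KU) dK subrr mulr0.
(* Within [M] the space [U] has codimension at most 1, and [K] is not inside it. *)
have -> : \dim (K :&: U) = k.-1.
  have := dimv_sum_cap K (M :&: U); rewrite capvA (capv_idPl KM).
  have : (\dim (K + M :&: U) <= \dim M)%N by rewrite dimvS // subv_add KM capvSl.
  have : (\dim (K :&: U) < k)%N.
    rewrite -dK ltnNge; apply: contra KU => dKU.
    have /eqP <- : (K :&: U == K)%VS by rewrite eqEdim capvSl.
    exact: capvSr.
  by rewrite dK; lia.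
rewrite mulVf // subr_eq0 gt_eqF // ltr_eXn2l //.
by rewrite prednK.
Qed.

(** The explicit weights have the right sums, and by [vsum_inj] no other weights do. *)
Lemma zero_shape_type w f M : w 0 = 0 -> (forall a v, a != 0 -> w (a *: v) = w v) ->
    (k < \dim M)%N -> zero_shape f M ->
    (forall K, (K <= M)%VS -> \dim K = k -> (f K)%:R = vsum w K) ->
  zero_type w M.
Proof.
move=> w0 wZ kM shape fE.
have inj h : h 0 = 0 -> (forall a v, a != 0 -> h (a *: v) = h v) ->
    (forall K, (K <= M)%VS -> \dim K = k -> (f K)%:R = vsum h K) -> {in M, w =1 h}.
  move=> h0 hZ hE v vM; apply/eqP; rewrite -subr_eq0; apply/eqP.
  apply: (@vsum_inj _ _ _ (fun v => w v - h v) M k) vM.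
  - by rewrite w0 h0 subrr.
  - by move=> a x a0; rewrite wZ // hZ.
  - by rewrite k_gt0.
  move=> K KM dK; rewrite /vsum sumrB -/(vsum w K) -/(vsum h K).
  by rewrite -fE // -hE // subrr.
case: shape => [[p pE]|[U [p [pU dM pE]]]]; [left | right].
  exists p; apply: inj => [|a v|K KM dK].
  - by rewrite /point_weight /through eqxx mul0r.
  - exact: point_weightZ.
  - by rewrite pE // vsum_point_weight.
exists U, p; split=> //; apply: inj => [|a v|K KM dK].
- by rewrite /affine_weight mem0v mul0r.
- exact: affine_weightZ.
- by rewrite pE // (vsum_affine_weight pU dM).
Qed.

End ZeroType.

(** * The possible values of a weight *)

Section WeightValues.
Variables (R : realFieldType) (F : finFieldType) (d k : nat).
Hypothesis k_gt1 : (1 < k)%N.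
Local Notation V := 'rV[F]_d.
Local Notation o := (wpoint R F).
Local Notation t := (waffine R F k).
Local Notation u := (wunit R F k).
Implicit Types (M : {vspace V}) (w : V -> R).

(** These gaps separate 0, o, t and the negative value t - o. They follow from q^(k-1) >= 2, since
    1/t is q^(k-1) (q - 1). *)
Lemma weight_order : [/\ 0 < u, u < t, 2 * t <= o & 0 < o].
Proof.
have q1 := q_gt1 R F; have q2 : 2 <= #|F|%:R :> R by rewrite ler_nat finNzRing_gt1.
have qk : 2 <= #|F|%:R ^+ k.-1 :> R.
  rewrite (le_trans q2) // -[leLHS]expr1 ler_weXn2l ?(ltW q1) //.
  by rewrite -ltnS prednK // ltnW.
have qkE : #|F|%:R ^+ k = #|F|%:R * #|F|%:R ^+ k.-1 :> R.
  by rewrite -exprS prednK // ltnW.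
rewrite /wunit /waffine /wpoint qkE.
move: (#|F|%:R : R) (_ ^+ k.-1 : R) q1 q2 qk => q r q1 q2 r2.
have p1 : 0 < q * r - r by nra.
have p2 : 0 < q * r - 1 by nra.
have p3 : 0 < q - 1 by lra.
rewrite !invr_gt0; split=> //; first by rewrite ltf_pV2 ?posrE //; nra.
by rewrite -[leRHS]mul1r ler_pdivlMr // mulrAC ler_pdivrMr //; nra.
Qed.

Lemma zero_type_values w M v : zero_type k w M -> v \in M ->
  [\/ w v = 0, w v = o, w v = t | w v = t - o].
Proof.
case=> [[p wE]|[U [p [_ _ wE]]]] vM; rewrite wE //.
  rewrite /point_weight; case: (through _ _); rewrite ?mul1r ?mul0r.
    by constructor 2.
  by constructor 1.
rewrite /affine_weight; case: (v \in U); rewrite ?mul0r ?mul1r; first by constructor 1.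
case: (v \in _); rewrite ?mul0r ?mul1r ?subr0; first by constructor 4.
by constructor 3.
Qed.

(** Two of the values 0, o, t, t - o add up to at most 0 or at least t, while 0 < u < t. *)
Lemma zero_type_compl w w' M M' v : zero_type k w M -> zero_type k w' M' ->
  v \in M -> v \in M' -> w v + w' v = u -> False.
Proof.
move=> wM wM' vM vM'; have [u0 ut to o0] := weight_order.
by case: (zero_type_values wM vM) => ->; case: (zero_type_values wM' vM') => -> E; lra.
Qed.

End WeightValues.

(** * Singular vectors, isotropic spaces and polar spaces carried by subspaces *)

Section Geometry.
Variables (F : finFieldType) (d : nat) (phi : classical_form F d).
Local Notation V := 'rV[F]_d.
Implicit Types (K U M W : {vspace V}) (a b c u v w x y z : V).

Definition bil u v : F :=
  match phi with
  | Orthogonal B _ => B u v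
  | Symplectic B => B u v
  | Unitary _ B => B u v
  end.

(** The vectors spanning isotropic subspaces. The orthogonal case needs [Q], as in characteristic 2
    its polarisation vanishes on every pair [v], [v]. *)
Definition sing v : bool :=
  match phi with
  | Orthogonal _ Q => Q v == 0
  | Symplectic _ => true
  | Unitary _ B => B v v == 0
  end.

Lemma bilDl u v w : bil (u + v) w = bil u w + bil v w.
Proof. by rewrite /bil; case: phi => [B Q|B|th B]; rewrite linearDl. Qed.

Lemma bilDr u v w : bil u (v + w) = bil u v + bil u w.
Proof. by rewrite /bil; case: phi => [B Q|B|th B]; rewrite linearDr. Qed.

Lemma bilZl (s : F) u w : bil (s *: u) w = s * bil u w.
Proof. by rewrite /bil; case: phi => [B Q|B|th B]; rewrite linearZl_LR. Qed.

Lemma bilNl u w : bil (- u) w = - bil u w.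
Proof. by rewrite -scaleN1r bilZl mulN1r. Qed.

Lemma bilBl u v w : bil (u - v) w = bil u w - bil v w.
Proof. by rewrite bilDl bilNl. Qed.

Lemma bil_sym u v : (bil u v == 0) = (bil v u == 0).
Proof. by rewrite /bil; case: phi => [B Q|B|th B]; rewrite herm_eq0C. Qed.

Lemma bil_sym0 u v : bil u v = 0 -> bil v u = 0.
Proof. by move=> /eqP; rewrite bil_sym => /eqP. Qed.

Lemma bil0l u : bil 0 u = 0.
Proof. by rewrite -(scale0r 0) bilZl mul0r. Qed.

Lemma bilZr0 (s : F) u w : bil u w = 0 -> bil u (s *: w) = 0.
Proof. by move=> /bil_sym0 uw; apply: bil_sym0; rewrite bilZl uw mulr0. Qed.

Lemma mem_perpP U u : reflect {in U, forall v, bil u v = 0} (u \in perp phi U).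
Proof. by rewrite /bil; case: phi => [B Q|B|th B]; apply: mem_orthovP. Qed.

Lemma mem_perp1 u v : (u \in perp phi <[v]>) = (bil u v == 0).
Proof. by rewrite /bil; case: phi => [B Q|B|th B]; apply: mem_orthov1. Qed.

Lemma dim_cap_perp1 U u : (\dim U <= (\dim (U :&: perp phi <[u]>)).+1)%N.
Proof.
have : ((\dim U).-1 <= \dim (U :&: perp phi <[u]>))%N.
  by rewrite /bil; case: phi => [B Q|B|th B]; apply: leq_dim_orthov1.
by case: (\dim U).
Qed.

Lemma isotropicP U :
  reflect ({in U, forall v, sing v} /\ {in U &, forall u v, bil u v = 0})
          (isotropic phi U).
Proof.
have perpE : (U <= perp phi U)%VS <-> {in U &, forall u v, bil u v = 0}.
  split=> [/subvP Up u v uU vU|UU]; first by apply: (mem_perpP _ _ (Up u uU)).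
  by apply/subvP => u uU; apply/mem_perpP => v vU; apply: UU.
rewrite /isotropic; case E: phi => [B Q|B|th B]; rewrite -E.
- apply: (iffP andP) => [[/perpE UU /'forall_implyP Qs]|[Us /perpE UU]].
    by split=> // v vU; rewrite /sing E Qs.
  by split=> //; apply/'forall_implyP => v vU; have := Us v vU; rewrite /sing E.
- rewrite andbT; apply: (iffP idP) => [/perpE UU|[_ /perpE //]].
  by split=> // v _; rewrite /sing E.
rewrite andbT; apply: (iffP idP) => [/perpE UU|[_ /perpE //]].
by split=> // v vU; have := UU v v vU vU; rewrite /sing /bil E => ->.
Qed.

Lemma isotropicS K M : (K <= M)%VS -> isotropic phi M -> isotropic phi K.
Proof.
move=> /subvP KM /isotropicP[Ms MM]; apply/isotropicP.
by split=> [v /KM/Ms //|u v /KM uM /KM vM]; apply: MM.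
Qed.

Lemma isotropic_sing U v : isotropic phi U -> v \in U -> sing v.
Proof. by case/isotropicP=> Us _; apply: Us. Qed.

Lemma isotropic_bil U u v : isotropic phi U -> u \in U -> v \in U -> bil u v = 0.
Proof. by case/isotropicP=> _; apply. Qed.

Variable e : polar_type.
Hypothesis phiP : form_of_type e phi.

Lemma singZ (s : F) v : sing v -> sing (s *: v).
Proof.
move: phiP; rewrite /sing /form_of_type; case: phi => [B Q|//|th B].
  by case: e => // -[QZ _ _] /eqP Qv; rewrite QZ Qv mulr0.
by move=> _ /eqP Bv; rewrite linearZl_LR linearZr_LR /= Bv !mulr0.
Qed.

Lemma sing0 : sing 0.
Proof.
move: phiP; rewrite /sing /form_of_type; case: phi => [B Q|//|th B].
  by case: e => // -[QZ _ _]; rewrite -(scale0r 0) QZ expr0n mul0r.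
by rewrite linear0l.
Qed.

Lemma singD u v : sing u -> sing v -> bil u v = 0 -> sing (u + v).
Proof.
move=> + + uv; have := bil_sym0 uv; move: uv phiP.
rewrite /sing /bil /form_of_type; case: phi => [B Q|//|th B] uv.
  by case: e => // -[_ QD _] _ /eqP Qu /eqP Qv; rewrite QD Qu Qv uv !addr0.
by move=> _ vu /eqP uu /eqP vv; rewrite linearDl !linearDr /= uu vv uv vu !addr0.
Qed.

Lemma singB u v : sing u -> sing v -> bil u v = 0 -> sing (u - v).
Proof.
by move=> su sv uv; apply: singD => //; rewrite -?scaleN1r; [apply: singZ | apply: bilZr0].
Qed.

Lemma sing_bil u : sing u -> bil u u = 0.
Proof.
move: phiP; rewrite /sing /bil /form_of_type; case: phi => [B Q|B|th B].
- move=> H /eqP Qu; have [QZ QD _] : nondegenerate_quadratic B Q by move: H; case: e.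
  by have := QD u u; rewrite -mulr2n -scaler_nat QZ Qu mulr0 !add0r.
- move=> H _; have [_ _ alt] : is_psymplectic B by move: H; case: e.
  have [/alt //|c2] := boolP (2%N \in [pchar F]).
  have /eqP := hermC B u u; rewrite /= expr1 mulN1r -subr_eq0 opprK -mulr2n -mulr_natl.
  by rewrite mulf_eq0 => /orP[/eqP two0|/eqP //]; case/negP: c2; rewrite inE /= two0.
by move=> _ /eqP.
Qed.

(** In each type the condition on [s] is solved explicitly; in the unitary case it prescribes the
    trace of [s * bil u v]. *)
Lemma sing_hyperbolic u v : sing u -> bil u v != 0 -> exists s, sing (v + s *: u).
Proof.
move=> su uv; have uu := sing_bil su.
move: phiP su uv uu; rewrite /sing /bil /form_of_type; case: phi => [B Q|B|th B].
- move=> H /eqP Qu Buv _.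
  have [QZ QD _] : nondegenerate_quadratic B Q by move: H; case: e.
  have Bvu : B v u != 0 by rewrite herm_eq0C.
  exists (- Q v / B v u); rewrite QD QZ Qu mulr0 addr0 linearZr_LR /=.
  by rewrite divfK // addrN.
- by exists 0.
- move=> H _ Buv uu.
  have [thK thN _] : [/\ involutive th, ~ th =1 id & is_unitary B] by move: H; case: e.
  (* An element of nonzero trace: otherwise theta is - id, and theta 1 = 1 gives -1 = 1, so that
     theta is the identity. *)
  have [x x0] : exists x : F, x + th x != 0.
    have [/existsP[x x0]|] := boolP [exists x : F, x + th x != 0]; first by exists x.
    rewrite negb_exists => /forallP th0; case: thN => x.
    have thE (y : F) : th y = - y.
      by apply/eqP; rewrite -addr_eq0 addrC; have := th0 y; rewrite negbK.
    have := thE 1; rewrite rmorph1 => E.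
    by rewrite thE -[x in RHS]mul1r E mulN1r.
  pose s := x + th x; have ths : th s = s by rewrite /s rmorphD thK addrC.
  have Bvv : th (B v v) = B v v by rewrite [RHS]hermC /= expr0 mul1r.
  (* Both [B v v] and the trace of [x] are fixed by theta, so the multiple of [u] contributes a
     trace equal to [- B v v]. *)
  exists (- (B v v) * x / s / B u v).
  rewrite linearDl !linearDr /= !linearZl_LR !linearZr_LR /= uu !mulr0 addr0.
  rewrite [B v u]hermC /= expr0 mul1r divfK // !rmorphM /= !fmorphV ths rmorphN Bvv.
  rewrite divfK ?fmorph_eq0 // -addrA -mulrDl -mulrDr [th x + x]addrC mulfK //.
  by rewrite addrN.
Qed.

Lemma sing_radical v : sing v -> (forall u, bil u v = 0) -> v = 0.
Proof.
move=> + vr; have vr' u := bil_sym0 (vr u).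
move: phiP vr'; rewrite /sing /bil /form_of_type; case: phi => [B Q|B|th B] H vr' sv.
- have [_ _ nd] : nondegenerate_quadratic B Q by move: H; case: e.
  by apply: nd (eqP sv); apply/mem_orthovP => u _; apply: vr'.
- have [nd _ _] : is_psymplectic B by move: H; case: e.
  by apply/eqP; rewrite -memv0 -(eqP nd); apply/mem_orthovP => u _; apply: vr'.
have [nd _] : is_unitary B by move: H; case: e => // -[].
by apply/eqP; rewrite -memv0 -(eqP nd); apply/mem_orthovP => u _; apply: vr'.
Qed.

Lemma isotropic_add_line K v : isotropic phi K -> sing v ->
  {in K, forall u, bil u v = 0} -> isotropic phi (K + <[v]>).
Proof.
case/isotropicP=> Ks KK sv Kv; apply/isotropicP; split=> [x|x y].
  case/memv_addP=> u uK [_ /vlineP[s ->] ->].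
  by apply: singD; [apply: Ks | apply: singZ | apply: bilZr0; apply: Kv].
case/memv_addP=> u uK [_ /vlineP[s ->] ->].
case/memv_addP=> u' u'K [_ /vlineP[s' ->] ->].
rewrite bilDl !bilDr !bilZl KK // (bilZr0 _ (Kv _ uK)) (bil_sym0 (Kv _ u'K)).
by rewrite (bilZr0 _ (sing_bil sv)) !mulr0 !addr0.
Qed.

Lemma isotropic_line v : sing v -> isotropic phi <[v]>.
Proof.
move=> sv; rewrite -[X in isotropic _ X]add0v; apply: isotropic_add_line => //.
  by apply/isotropicP; split=> [x|x y]; rewrite memv0 => /eqP ->; rewrite ?sing0 ?bil0l.
by move=> u; rewrite memv0 => /eqP ->; rewrite bil0l.
Qed.

(** Exchange argument: for [v] in [K] outside [M], the space [(M :&: perp phi <[v]>) + <[v]>] is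
    isotropic, not smaller than [M], and meets [K] in more, because [K :&: M] is orthogonal to
    [v]. *)
Lemma isotropic_extend U K M : isotropic phi K -> isotropic phi M ->
    (K <= U)%VS -> (M <= U)%VS ->
  exists M', [/\ isotropic phi M', (K <= M')%VS, (M' <= U)%VS & (\dim M <= \dim M')%N].
Proof.
move=> Ki + KU; move: {2}(\dim K - \dim (K :&: M))%N (leqnn (\dim K - \dim (K :&: M))%N) => m.
elim: m M => [|m IHm] M.
  rewrite leqn0 subn_eq0 => dK Mi MU; exists M; split=> //.
  have /eqP <- : (K :&: M == K)%VS by rewrite eqEdim capvSl.
  exact: capvSr.
move=> dm Mi MU; have [KM|/subvPn[v vK vM]] := boolP (K <= M)%VS; first by exists M.
pose M1 := ((M :&: perp phi <[v]>) + <[v]>)%VS.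
have M1i : isotropic phi M1.
  apply: isotropic_add_line; first exact: isotropicS (capvSl _ _) Mi.
    exact: isotropic_sing vK.
  by move=> u; rewrite memv_cap mem_perp1 => /andP[_ /eqP].
have dM1 : (\dim M <= \dim M1)%N.
  rewrite dim_add_line_notin ?dim_cap_perp1 //.
  by apply: contra vM; rewrite memv_cap => /andP[].
have dK1 : (\dim (K :&: M) < \dim (K :&: M1))%N.
  have vKM : v \notin (K :&: M)%VS by rewrite memv_cap negb_and vM orbT.
  rewrite -(dim_add_line_notin vKM) dimvS // subv_add -memvE memv_cap vK.
  rewrite (subvP (addvSr _ _)) ?memv_line // subv_cap capvSl /= andbT.
  apply/subvP => u; rewrite memv_cap => /andP[uK uM].
  rewrite (subvP (addvSl _ _)) // memv_cap uM mem_perp1.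
  by rewrite (isotropic_bil Ki uK vK) eqxx.
have dKM : (\dim (K :&: M1) <= \dim K)%N by rewrite dimvS ?capvSl.
have [||M' [M'i KM' M'U dM']] := IHm M1 _ M1i; first by lia.
  rewrite subv_add (subv_trans (capvSl _ _) MU) -memvE; exact: (subvP KU).
by exists M'; split=> //; apply: leq_trans dM'.
Qed.

(** The singular vectors of [U] carry a nondegenerate polar space, and [r] is a lower bound for its
    rank. *)
Definition polar_on U r : Prop :=
  (forall v, v \in U -> sing v -> {in U, forall u, bil u v = 0} -> v = 0) /\
  (exists M, [/\ isotropic phi M, (M <= U)%VS & \dim M = r]).

Lemma polar_extend U r K : polar_on U r -> isotropic phi K -> (K <= U)%VS ->
    (\dim K <= r)%N ->
  exists M, [/\ isotropic phi M, (K <= M)%VS, (M <= U)%VS & \dim M = r].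
Proof.
move=> [_ [M [Mi MU dM]]] Ki KU dK.
have [M1 [M1i KM1 M1U dM1]] := isotropic_extend Ki Mi KU MU.
have [|M2 [KM2 M21 dM2]] := @exists_subspace_between _ _ M1 K r KM1.
  by rewrite dK -dM.
by exists M2; split=> //; [apply: isotropicS M1i | apply: subv_trans M1U].
Qed.

(** Some vector of [U] is not orthogonal to [v], and [sing_hyperbolic] makes it singular by adding a
    multiple of [v]. *)
Lemma polar_partner U r v : polar_on U r -> v \in U -> sing v -> v != 0 ->
  exists b, [/\ b \in U, sing b & bil b v != 0].
Proof.
move=> [nd _] vU sv v0.
have [/existsP[u /andP[uU uv]]|] := boolP [exists u, (u \in U) && (bil u v != 0)].
  have [|s s_sing] := @sing_hyperbolic v u sv; first by rewrite bil_sym.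
  exists (u + s *: v); split=> //; first by rewrite rpredD ?rpredZ.
  by rewrite bilDl bilZl (sing_bil sv) mulr0 addr0.
rewrite negb_exists => /forallP H; case/eqP: v0; apply: nd => // u uU.
by have := H u; rewrite uU negbK => /eqP.
Qed.

(** For a hyperbolic pair this is the complement of the hyperbolic line, a polar space of rank one
    less. *)
Definition hperp U a b := (U :&: perp phi <[a]> :&: perp phi <[b]>)%VS.

Lemma mem_hperp U a b u : (u \in hperp U a b) = [&& u \in U, bil u a == 0 & bil u b == 0].
Proof. by rewrite !memv_cap !mem_perp1 andbA. Qed.

Lemma hyperbolic_split U a b u : a \in U -> b \in U -> sing a -> sing b ->
    bil a b != 0 -> u \in U ->
  exists s1 s2 w, w \in hperp U a b /\ u = s1 *: a + s2 *: b + w.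
Proof.
move=> aU bU sa sb ab uU; have ba : bil b a != 0 by rewrite bil_sym.
pose s1 := bil u b / bil a b; pose s2 := bil u a / bil b a.
exists s1, s2, (u - s1 *: a - s2 *: b); split; last first.
  by rewrite -[u - _ - _]addrA -opprD addrCA subrr addr0.
rewrite mem_hperp !rpredB ?rpredZ //= !bilBl !bilZl (sing_bil sa) (sing_bil sb).
by rewrite !mulr0 !subr0 !divfK // !subrr eqxx.
Qed.

(** By [hyperbolic_split] a radical vector of the complement is radical in [U]. An isotropic r-space
    is found in the perp of [b] inside an isotropic (r+1)-space through [a]. *)
Lemma polar_hperp U r a b : polar_on U r.+1 -> a \in U -> b \in U -> sing a -> sing b ->
  bil a b != 0 -> polar_on (hperp U a b) r.
Proof.
move=> PU aU bU sa sb ab; split=> [v|].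
  rewrite mem_hperp => /and3P[vU va vb] sv vW; apply: PU.1 => // u uU.
  have [s1 [s2 [w [wW ->]]]] := hyperbolic_split aU bU sa sb ab uU.
  rewrite !bilDl !bilZl (vW w wW) [bil a v](bil_sym0 (eqP va)).
  by rewrite [bil b v](bil_sym0 (eqP vb)) !mulr0 !addr0.
have [||M [Mi aM MU dM]] := polar_extend PU (isotropic_line sa).
- by rewrite -memvE.
- by rewrite dim_vline; case: (_ != _).
have [||N [_ NM dN]] := @exists_subspace_between _ _ (M :&: perp phi <[b]>)%VS 0%VS r.
- exact: sub0v.
- by rewrite dimv0 /= -ltnS -dM dim_cap_perp1.
exists N; split=> //; first by apply: isotropicS Mi; apply: subv_trans NM (capvSl _ _).
apply/subvP => u /(subvP NM); rewrite memv_cap mem_perp1 mem_hperp => /andP[uM ->].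
by rewrite (subvP MU) // (isotropic_bil Mi uM) ?eqxx // memvE.
Qed.

Lemma polar_point U r : polar_on U r.+1 -> exists v, [/\ v \in U, sing v & v != 0].
Proof.
move=> [_ [M [Mi MU dM]]]; have M0 : M != 0%VS by rewrite -dimv_eq0 dM.
exists (vpick M); split; first by rewrite (subvP MU) ?memv_pick.
  by rewrite (isotropic_sing Mi) ?memv_pick.
by rewrite vpick0.
Qed.

Lemma polar_hyperbolic U r : polar_on U r.+1 ->
  exists a b, [/\ a \in U, b \in U, sing a, sing b & bil a b != 0].
Proof.
move=> PU; have [b [bU sb b0]] := polar_point PU.
by have [a [aU sa ab]] := polar_partner PU bU sb b0; exists a, b.
Qed.

(* The pair is found in the residue of p, that is in the space orthogonal to p
   and to some point opposite p. *)
Lemma polar_hyperbolic_perp U r p : polar_on U r.+2 -> p \in U -> sing p -> p != 0 ->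
  exists a b, [/\ (a \in U) && (b \in U), sing a && sing b, bil a p = 0, bil b p = 0
    & bil a b != 0].
Proof.
move=> PU pU sp p0; have [c [cU sc cp]] := polar_partner PU pU sp p0.
have [a [b [aW bW sa sb ab]]] := polar_hyperbolic (polar_hperp PU cU pU sc sp cp).
exists a, b; move: aW bW; rewrite !mem_hperp sa sb.
by move=> /and3P[-> _ /eqP ->] /and3P[-> _ /eqP ->].
Qed.

Lemma dim_hperp a b : sing a -> sing b -> bil a b != 0 ->
  (\dim (hperp fullv a b)).+2 = d.
Proof.
move=> sa sb ab.
have dV : \dim (fullv : {vspace V}) = d by rewrite dimvf /dim /= mul1n.
have aW : a \notin hperp fullv a b by rewrite mem_hperp (negbTE ab) !andbF.
have bW : b \notin (hperp fullv a b + <[a]>)%VS.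
  apply/negP => /memv_addP[w]; rewrite mem_hperp => /and3P[_ /eqP wa _].
  case=> _ /vlineP[s ->] bE; case/negP: ab; rewrite bil_sym bE.
  by rewrite bilDl bilZl wa (sing_bil sa) mulr0 addr0.
apply/eqP; rewrite eqn_leq; apply/andP; split.
  by rewrite -[X in (_ <= X)%N]dV -(dim_add_line_notin aW) -(dim_add_line_notin bW) dimvS ?subvf.
rewrite -[X in (X <= _)%N]dV; apply: leq_trans (dim_cap_perp1 _ a) _.
by rewrite ltnS dim_cap_perp1.
Qed.

End Geometry.

(** * Geometric hyperplanes *)

Section GeometricHyperplanes.
Variables (F : finFieldType) (d : nat) (phi : classical_form F d) (e : polar_type).
Hypothesis phiP : form_of_type e phi.
Local Notation V := 'rV[F]_d.
Local Notation bil := (bil phi).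
Local Notation sing := (sing phi).
Local Notation hperp := (hperp phi).
Implicit Types (H U W : {vspace V}) (a b p v w x y z : V).

(** [X] plays the role of a subspace of the polar space, closed under sums of orthogonal vectors
    only. It will be [hweight], and once membership in a hyperplane. *)
Variable X : V -> Prop.
Hypothesis XZ : forall (s : F) x, sing x -> X x -> X (s *: x).
Hypothesis XD : forall x y, sing x -> sing y -> bil x y = 0 -> X x -> X y -> X (x + y).

(* Singular vectors of X outside H propagate along orthogonality to every
   singular vector outside H, and any two of these are joined by a path of length at
   most three outside H. *)
Lemma geometric_hyperplane_maximal r H p :
    polar_on phi fullv r.+2 ->
    (forall z v, z \notin H -> exists s, v - s *: z \in H) ->
    (forall z, z \in H -> sing z -> X z) ->
    sing p -> ~ X p ->
  forall x, sing x -> X x -> x \in H.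
Proof.
move=> PV Hhyp HX sp Xp x sx Xx; apply/negPn/negP => xH.
have pH : p \notin H by apply/negP => pH; apply/Xp/HX.
(* [y - s *: z] is singular by orthogonality and lies in [H], so [y] is the sum of two orthogonal
   singular vectors of [X]. *)
have step z y : sing z -> X z -> z \notin H -> sing y -> bil y z = 0 -> X y.
  move=> sz Xz zH sy yz; have [s ysz] := Hhyp z y zH.
  have yzs : sing (y - s *: z).
    by apply: (singB phiP) => //; [apply: singZ phiP _ _ _ | apply: bilZr0].
  rewrite -(subrK (s *: z) y); apply: XD => //; last exact: XZ.
  - exact: singZ phiP _ _ _.
  - by apply: bilZr0; rewrite bilBl bilZl yz (sing_bil phiP sz) mulr0 subrr.
  exact: HX.
have [px|px] := eqVneq (bil p x) 0; first by apply: Xp; apply: step px.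
have [y' [y [y'W yW sy' sy y'y]]] := polar_hyperbolic phiP
  (polar_hperp phiP PV (memvf p) (memvf x) sp sx px).
move: y'W yW; rewrite !mem_hperp !memvf /=.
move=> /andP[/eqP y'p /eqP y'x] /andP[/eqP yp /eqP yx].
(* Otherwise [x], [y1], [p] is a path outside [H]. *)
have Xof y1 : sing y1 -> bil y1 x = 0 -> bil y1 p = 0 -> y1 \in H.
  move=> sy1 y1x y1p; apply/negPn/negP => y1H; apply: Xp.
  by apply: (step y1) => //; [apply: (step x) | apply: bil_sym0].
have yH := Xof y sy yx yp; have y'H := Xof y' sy' y'x y'p.
have sxy : sing (x + y) by apply: (singD phiP) => //; apply: bil_sym0.
have xyH : x + y \notin H by rewrite rpredDr.
have Xxy : X (x + y).
  by apply: (step x) => //; rewrite bilDl yx addr0 (sing_bil phiP sx).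
(* With this [s] the path [x], [x + y], [p + s *: y'], [p] has orthogonal neighbours; it avoids [H]
   because [y] and [y'] lie in [H]. *)
pose s := - bil p x / bil y' y.
have sps : sing (p + s *: y').
  by apply: (singD phiP) => //; [apply: singZ phiP _ _ _ | apply/bilZr0/bil_sym0].
have psH : p + s *: y' \notin H by rewrite rpredDr ?rpredZ.
apply: Xp; apply: (step (p + s *: y')) => //.
  apply: (step (x + y)) => //; rewrite bilDl !bilDr !bilZl.
  by rewrite y'x (bil_sym0 yp) mulr0 add0r addr0 divfK // addrN.
by rewrite bilDr (sing_bil phiP sp) add0r; apply/bilZr0/bil_sym0.
Qed.

(* With a vector y of Y not orthogonal to it, a singular vector z of H splits as the sum
   of two orthogonal singular vectors of H that are orthogonal to a and b respectively,
   hence lie in X. If there is no such y, split off a singular vector of Y first. *)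
Lemma geometric_hyperplane_glue r a b p Y :
    polar_on phi fullv r.+3 -> sing a -> sing b -> bil a b != 0 -> X a -> X b ->
    sing p -> p != 0 -> ~ X p -> p \in hperp fullv a b ->
    (Y <= hperp fullv a b)%VS ->
    (forall w, w \in hperp fullv a b -> exists s, w - s *: p \in Y) ->
    (forall z, z \in Y -> sing z -> X z) ->
  exists H, [/\ p \notin H, (\dim H).+1 = d & forall z, z \in H -> sing z -> X z].
Proof.
move=> PV sa sb ab Xa Xb sp p0 Xp pW /subvP YW Yhyp YX.
have PW := polar_hperp phiP PV (memvf a) (memvf b) sa sb ab.
have Ya z : z \in Y -> bil z a = 0 by move=> /YW; rewrite mem_hperp => /and3P[_ /eqP ->].
have Yb z : z \in Y -> bil z b = 0 by move=> /YW; rewrite mem_hperp => /and3P[_ _ /eqP ->].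
(* A hyperbolic pair orthogonal to [p], moved into [Y] along [p], which does not change the value of
   the form. *)
have [y [y' [yY y'Y sy sy' yy']]] :
    exists y y', [/\ y \in Y, y' \in Y, sing y, sing y' & bil y y' != 0].
  have [y [y' [/andP[yW y'W] /andP[sy sy'] yp y'p yy']]] :=
    polar_hyperbolic_perp phiP PW pW sp p0.
  have [s yY] := Yhyp y yW; have [s' y'Y] := Yhyp y' y'W.
  exists (y - s *: p), (y' - s' *: p); split=> //.
  - by apply: (singB phiP) => //; [apply: singZ phiP _ _ _ | apply: bilZr0].
  - by apply: (singB phiP) => //; [apply: singZ phiP _ _ _ | apply: bilZr0].
  rewrite bilBl bilZl -scaleNr !bilDr (bilZr0 _ yp) (bilZr0 _ (sing_bil phiP sp)).
  by rewrite (bil_sym0 y'p) !addr0 mulr0 subr0.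
pose H := (<[a]> + <[b]> + Y)%VS.
have HP z : z \in H -> exists s1 s2 w, w \in Y /\ z = s1 *: a + s2 *: b + w.
  case/memv_addP=> _ /memv_addP[_ /vlineP[s1 ->] [_ /vlineP[s2 ->] ->]] [w wY ->].
  by exists s1, s2, w.
have generic s1 s2 w : w \in Y -> sing (s1 *: a + s2 *: b + w) ->
    (exists y1, [/\ y1 \in Y, sing y1 & bil y1 w != 0]) -> X (s1 *: a + s2 *: b + w).
  set z := _ + w => wY sz [y1 [y1Y sy1 y1w]].
  have y1z : bil y1 z = bil y1 w.
    by rewrite !bilDr (bilZr0 _ (Ya _ y1Y)) (bilZr0 _ (Yb _ y1Y)) !add0r.
  (* Chosen to make [z1] orthogonal to [z], hence to [z2 = z - z1], which is then singular. *)
  pose s := - bil (s1 *: a) z / bil y1 z.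
  pose z1 := s1 *: a + s *: y1; pose z2 := s2 *: b + (w - s *: y1).
  have zE : z = z1 + z2 by rewrite /z1 /z2 addrACA subrKC.
  have s1y : bil (s1 *: a) (s *: y1) = 0.
    by apply: bilZr0; rewrite bilZl (bil_sym0 (Ya _ y1Y)) mulr0.
  have sz1 : sing z1 by apply: (singD phiP) => //; apply: (singZ phiP).
  have z1z : bil z1 z = 0.
    by rewrite /z1 bilDl [bil (s *: y1) _]bilZl divfK ?addrN // y1z.
  have z1z2 : bil z1 z2 = 0.
    by have := z1z; rewrite zE bilDr (sing_bil phiP sz1) add0r.
  have sz2 : sing z2.
    have -> : z2 = z - z1 by rewrite zE addrAC subrr add0r.
    by apply: (singB phiP) => //; apply: bil_sym0.
  have w'Y : w - s *: y1 \in Y by rewrite rpredB // rpredZ.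
  have ssb : sing (s2 *: b) by apply: (singZ phiP).
  have bw' : bil (s2 *: b) (w - s *: y1) = 0.
    by rewrite bilZl (bil_sym0 (Yb _ w'Y)) mulr0.
  have sw' : sing (w - s *: y1).
    have -> : w - s *: y1 = z2 - s2 *: b by rewrite /z2 addrAC subrr add0r.
    apply: (singB phiP) => //; apply: bil_sym0.
    by rewrite /z2 bilDr bw' (sing_bil phiP ssb) addr0.
  rewrite zE; apply: XD => //; apply: XD => //; try exact: (singZ phiP).
  - exact: XZ.
  - by apply: XZ => //; apply: YX.
  - exact: XZ.
  exact: YX.
have HX z : z \in H -> sing z -> X z.
  move=> /HP[s1 [s2 [w [wY ->]]]] sz.
  have [/existsP[y1 /and3P[y1Y sy1 y1w]]|] :=
    boolP [exists y1, [&& y1 \in Y, sing y1 & bil y1 w != 0]].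
    by apply: generic => //; exists y1.
  rewrite negb_exists => /forallP exc.
  have Yw y1 : y1 \in Y -> sing y1 -> bil y1 w = 0.
    by move=> y1Y sy1; have := exc y1; rewrite y1Y sy1 negbK => /eqP.
  (* All singular vectors of [Y] are orthogonal to [w], so [y'] is split off: [y] is not orthogonal
     to [w - y']. *)
  have zy' : bil (s1 *: a + s2 *: b + w) y' = 0.
    rewrite !bilDl !bilZl (bil_sym0 (Ya _ y'Y)) (bil_sym0 (Yb _ y'Y)).
    by rewrite (bil_sym0 (Yw _ y'Y sy')) !mulr0 !addr0.
  have szy' := singB phiP sz sy' zy'.
  rewrite -(subrK y' (_ + w)); apply: XD => //; last exact: YX.
    by rewrite bilBl zy' (sing_bil phiP sy') subrr.
  rewrite -addrA; apply: generic; rewrite ?rpredB // ?addrA //.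
  exists y; split=> //; rewrite -scaleN1r bilDr (Yw _ yY sy) add0r.
  by rewrite bil_sym bilZl mulN1r oppr_eq0 bil_sym.
have pH : p \notin H by apply/negP => /HX; apply: contra_not Xp; apply.
exists H; split=> //; rewrite -(dim_add_line_notin pH).
have -> : (H + <[p]>)%VS = fullv.
  apply/eqP; rewrite eqEsubv subvf; apply/subvP => v _.
  have [s1 [s2 [w [wW ->]]]] := hyperbolic_split phiP (memvf a) (memvf b) sa sb ab (memvf v).
  have [s wY] := Yhyp w wW; rewrite -(subrK (s *: p) w) addrA.
  by rewrite memv_add ?memvZ ?memv_line // memv_add // memv_add ?memvZ ?memv_line.
by rewrite dimvf /dim /= mul1n.
Qed.

End GeometricHyperplanes.

(** * The hypothesis on rank n *)

Section WeightedPolarSpace.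
Variables (R : realType) (F : finFieldType) (d k : nat) (phi : classical_form F d).
Variable e : polar_type.
Hypothesis phiP : form_of_type e phi.
Hypothesis k_gt1 : (1 < k)%N.
Local Notation V := 'rV[F]_d.
Local Notation bil := (bil phi).
Local Notation sing := (sing phi).
Local Notation o := (wpoint R F).
Local Notation t := (waffine R F k).
Implicit Types (H K M U W Y : {vspace V}) (p v x z : V).

Let k_gt0 : (0 < k)%N := ltnW k_gt1.

Variables (w : V -> R) (f : {vspace V} -> bool).
Hypothesis fE : forall K, isotropic phi K -> \dim K = k -> (f K)%:R = vsum w K.

(* By affine_weight_hweight below, the weights of the points of the hyperplane U. *)
Definition hweight v : bool := (w v == 0) || (w v == o).

Lemma not_hweight v : w v = t \/ w v = t - o -> ~~ hweight v.
Proof.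
rewrite /hweight; have [u0 ut to o0] := weight_order R F k_gt1.
by case=> ->; rewrite negb_or; apply/andP; split; apply/eqP; lra.
Qed.

Lemma point_weight_hweight p v : w v = point_weight R p v -> hweight v.
Proof.
by rewrite /hweight /point_weight => ->; case: (through _ _);
   rewrite ?mul0r ?mul1r eqxx ?orbT.
Qed.

Lemma affine_weight_hweight U p v : w v = affine_weight R k U p v -> hweight v = (v \in U).
Proof.
rewrite /affine_weight; case: (boolP (v \in U)) => vU.
  by rewrite mul0r /hweight => ->; rewrite eqxx.
rewrite mul1r => wv; apply/negbTE/not_hweight; rewrite wv.
by case: (v \in _); rewrite ?mul1r ?mul0r ?subr0; [right | left].
Qed.

Lemma zero_type_affine M v : isotropic phi M -> zero_type k w M -> v \in M -> ~~ hweight v ->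
  exists U p, [/\ p \in U -> p = 0, (\dim M <= (\dim (M :&: U)).+1)%N, v \notin U
    & forall K, (K <= M)%VS -> \dim K = k ->
        f K = ~~ (K <= U)%VS && ~~ through p K].
Proof.
move=> Mi; case=> [[p wE]|[U [p [pU dM wE]]]] vM vX.
  by case/negP: vX; apply: point_weight_hweight (wE v vM).
exists U, p; split=> // [|K KM dK]; first by rewrite -(affine_weight_hweight (wE v vM)).
apply: (@bool_natr_inj R); rewrite fE ?(isotropicS KM) // -(vsum_affine_weight R k_gt0 pU dM KM dK).
by apply: eq_vsum => x /(subvP KM)/wE.
Qed.

(** The value t - o occurs only on the exceptional point of the affine alternative, so [v] spans the
    same point as [p]. *)
Lemma zero_type_negative M v : isotropic phi M -> zero_type k w M -> v \in M -> v != 0 ->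
    w v = t - o ->
  exists U, [/\ (\dim M <= (\dim (M :&: U)).+1)%N, v \notin U
    & forall K, (K <= M)%VS -> \dim K = k -> f K = ~~ (K <= U)%VS && (v \notin K)].
Proof.
move=> Mi wM vM v0 wv; have vX := not_hweight (or_intror wv).
case: (wM) => [[p wE]|[U [p [pU dM wE]]]].
  by case/negP: vX; apply: point_weight_hweight (wE v vM).
have vU : v \notin U by rewrite -(affine_weight_hweight (wE v vM)).
exists U; split=> // K KM dK.
have vp : v \in <[p]>%VS.
  apply/negPn/negP => vp; have := wE v vM; rewrite /affine_weight vU (negbTE vp).
  rewrite wv mul1r mul0r subr0 => E; have [u0 ut to o0] := weight_order R F k_gt1.
  by move: E; lra.
have p0 : p != 0.
  by apply: contraNneq v0 => p0; move: vp; rewrite p0 => /vlineP[s ->]; rewrite scaler0.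
have throughE : through p K = (v \in K).
  rewrite /through p0 /=; apply/idP/idP => [pK|vK].
    by apply: subvP vp; rewrite -memvE.
  by have := vline_sym v0 vp; apply: subvP; rewrite -memvE.
rewrite -throughE; apply: (@bool_natr_inj R); rewrite fE ?(isotropicS KM) //.
rewrite -(vsum_affine_weight R k_gt0 pU dM KM dK).
by apply: eq_vsum => x /(subvP KM)/wE.
Qed.

Definition polar_or (S N T : {set {vspace V}}) K : bool :=
  [|| [exists p : {vspace V} in S, pointf p K], [exists H in N, hyperf H K]
    | [exists p : {vspace V} in T, hyperf (perp phi p) K && ~~ pointf p K]].

(** Triviality for the polar space carried by [W]. Perps are taken in the ambient space, which makes
    no difference for [K] inside [W]. *)
Definition polar_trivial_on W : Prop :=
  exists S N T : {set {vspace V}},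
    [/\ {in S, forall p : {vspace V}, isotropic phi p /\ \dim p = 1%N},
        {in N, forall H, (H <= W)%VS /\ (\dim H).+1 = \dim W},
        {in T, forall p : {vspace V}, isotropic phi p /\ \dim p = 1%N}
      & eq_upto_compl [set K | [&& isotropic phi K, \dim K == k & (K <= W)%VS]]
          f (polar_or S N T)].

Variables (W : {vspace V}) (r : nat).
Hypothesis PW : polar_on phi W r.
Hypothesis kr : (k.+2 <= r)%N.
Hypothesis wW : forall M, isotropic phi M -> (M <= W)%VS -> \dim M = r -> zero_type k w M.

Let kr1 : (k < r)%N := ltnW kr.
Let r_gt0 : (0 < r)%N := leq_ltn_trans (leq0n k) kr1.

(* Otherwise some k-space of Y that avoids x would not be contained in the hyperplane
   of a generator through z, and f would be 1 there. *)
Lemma vanishing_hyperplane_hweight Y x : (Y <= W)%VS -> (\dim W <= (\dim Y).+1)%N ->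
    (forall K, isotropic phi K -> (K <= Y)%VS -> \dim K = k -> ~~ through x K ->
       f K = false) ->
  forall z, z \in Y -> sing z -> hweight z.
Proof.
move=> YW dY fY z zY sz; apply/negPn/negP => zX.
have [||M [Mi zM MW dM]] := polar_extend phiP PW (isotropic_line phiP sz).
- by rewrite -memvE (subvP YW).
- by rewrite dim_vline (leq_trans (leq_b1 _)).
rewrite -memvE in zM.
have [U [p [pU dU zU fU]]] := zero_type_affine Mi (wW Mi MW dM) zM zX.
pose A := (M :&: Y)%VS; have zA : z \in A by rewrite memv_cap zM.
have kA : (k < \dim A)%N by rewrite -ltnS (leq_trans kr) // -dM (dim_cap_codim1 MW YW).
have AU : ~~ (A <= U)%VS by apply: contra zU => /subvP; apply.
have AD : ~~ (A <= <[p]> + <[x]>)%VS.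
  apply/negP => /dimvS/leq_trans/(_ (dim_add_lines _ _))/(leq_trans kA).
  by rewrite ltnS leqNgt k_gt1.
(* Containing [v] keeps [K] out of [U], and as [v] is on neither of the points [p] and [x], they can
   still be avoided. *)
have [v [vA vU vD]] := exists_notin2 AU AD.
have v0 : v != 0 by apply: contraNneq vU => ->; rewrite mem0v.
have avoid y : v \notin <[y]>%VS -> y \in <[v]>%VS -> y = 0.
  by move=> vy yv; apply/eqP; apply: contraNT vy => y0; apply: vline_sym y0 yv.
have [||||K [vK KA dK pK xK]] := @exists_subspace_avoiding _ _ A <[v]>%VS k p x.
- by rewrite -memvE.
- by rewrite dim_line // k_gt0.
- by apply: avoid; apply: contra vD; apply/subvP/addvSl.
- by apply: avoid; apply: contra vD; apply/subvP/addvSr.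
have KM := subv_trans KA (capvSl _ _).
have through_false y : (y \in K -> y = 0) -> through y K = false.
  by move=> yK; apply/negP => /andP[/eqP y0 /yK].
have := fY K; rewrite (isotropicS KM) // (subv_trans KA (capvSr _ _)) //.
rewrite (through_false x) // fU // (through_false p) // andbT => /(_ isT isT dK isT).
by move=> /negbFE/subvP/(_ v); rewrite memvE vK (negbTE vU) => /(_ isT).
Qed.

(** By [vanishing_hyperplane_hweight] it suffices to find a hyperplane [Y] of [W] such that [f]
    vanishes on its k-spaces not through some [x]. The description of [f] by [S], [N], [T] provides
    it, after comparison with [f] on a generator [M] through [p]. *)
Lemma polar_trivial_hyperplane p : p \in W -> sing p -> p != 0 -> w p = t - o ->
    polar_trivial_on W ->
  exists Y, [/\ (Y <= W)%VS, forall v, v \in W -> exists s, v - s *: p \in Y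
    & forall z, z \in Y -> sing z -> hweight z].
Proof.
move=> pW sp p0 wp [S [N [T [HS HN HT fST]]]].
have pX := not_hweight (or_intror wp).
have [||M [Mi pM MW dM]] := polar_extend phiP PW (isotropic_line phiP sp).
- by rewrite -memvE.
- by rewrite dim_vline p0.
rewrite -memvE in pM.
have [U [dU pU fU]] := zero_type_negative Mi (wW Mi MW dM) pM p0 wp.
suff [Y [x [YW dY fY]]] : exists Y x, [/\ (Y <= W)%VS, (\dim W <= (\dim Y).+1)%N
    & forall K, isotropic phi K -> (K <= Y)%VS -> \dim K = k -> ~~ through x K ->
       f K = false].
  have YX := vanishing_hyperplane_hweight YW dY fY; exists Y; split=> //.
  have pY : p \notin Y by apply: contra pX => /YX; apply.
  move=> v vW; have : v \in (Y + <[p]>)%VS.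
    have /eqP -> // : (Y + <[p]> == W)%VS.
    by rewrite eqEdim subv_add YW -memvE pW dim_add_line_notin.
  by case/memv_addP=> y yY [_ /vlineP[s ->] ->]; exists s; rewrite addrK.
have inD K : isotropic phi K -> (K <= W)%VS -> \dim K = k ->
    K \in [set K | [&& isotropic phi K, \dim K == k & (K <= W)%VS]].
  by move=> Ki KW dK; rewrite inE Ki dK eqxx.
have KMD K : (K <= M)%VS -> \dim K = k ->
    K \in [set K | [&& isotropic phi K, \dim K == k & (K <= W)%VS]].
  by move=> KM dK; apply: inD => //; [apply: isotropicS Mi | apply: subv_trans MW].
have pt (y : {vspace V}) : \dim y = 1%N -> exists2 x, x != 0 & y = <[x]>%VS.
  move=> dy; have y0 : y != 0%VS by rewrite -dimv_eq0 dy.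
  exists (vpick y); first by rewrite vpick0.
  by apply/esym/eqP; rewrite eqEdim -memvE memv_pick dim_line ?vpick0 // dy.
have orS K (y : {vspace V}) : y \in S -> (y <= K)%VS -> polar_or S N T K.
  by move=> yS yK; apply/or3P; constructor 1; apply/existsP; exists y; rewrite yS.
have orN K H : H \in N -> (K <= H)%VS -> polar_or S N T K.
  by move=> HN' KH; apply/or3P; constructor 2; apply/existsP; exists H; rewrite HN'.
have orT K (y : {vspace V}) : y \in T -> (K <= perp phi y)%VS -> ~~ (y <= K)%VS -> polar_or S N T K.
  move=> yT Ky yK; apply/or3P; constructor 3; apply/existsP; exists y.
  by rewrite yT /hyperf Ky.
have kMU : (k < \dim (M :&: U))%N by rewrite -ltnS (leq_trans kr) // -dM.
(* If [f] is the complement of the disjunction, a hyperplane in [N] or the perp of a point in [T]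
   serves as [Y]. *)
case: fST => fST; last first.
  have [/existsP[H HN']|N0] := boolP [exists H, H \in N].
    have [HW dH] := HN H HN'; exists H, 0; split=> //; first by rewrite dH.
    move=> K Ki KH dK _; rewrite fST ?inD ?(subv_trans KH) //.
    by rewrite (orN K H).
  have [/existsP[y yT]|T0] := boolP [exists y : {vspace V}, y \in T].
    have [yi dy] := HT y yT; have [x x0 yE] := pt y dy.
    exists (W :&: perp phi y)%VS, x; split; rewrite ?capvSl //.
      by rewrite yE dim_cap_perp1.
    move=> K Ki; rewrite subv_cap => /andP[KW Ky] dK xK.
    rewrite fST ?inD // (orT K y) // yE -memvE.
    by apply: contra xK => xK; rewrite /through x0.
  (* With points only, a k-space of [M :&: U], where [f] is 0, contains a point of [S]. On a k-space
     of [M] through that point, not inside [U] and avoiding [p], [f] would be both 0 and 1. *)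
  have [|K [_ KA dK]] := @exists_subspace_between _ _ (M :&: U)%VS 0%VS k (sub0v _).
    by rewrite dimv0 /= ltnW.
  have KM := subv_trans KA (capvSl _ _); have KU := subv_trans KA (capvSr _ _).
  have := fU K KM dK; rewrite KU /= fST ?KMD // => /negbFE/or3P[|/existsP[H]|/existsP[y]].
  - case/existsP=> y /andP[yS yK]; have [_ /pt[x x0 yE]] := HS y yS.
    have xM : x \in M by rewrite memvE -yE (subv_trans yK).
    have xU : x \in U by rewrite memvE -yE (subv_trans yK).
    have MU : ~~ (M <= U)%VS by apply/negP => /subvP/(_ p pM); rewrite (negbTE pU).
    have Mxp : ~~ (M <= <[x]> + <[p]>)%VS.
      apply/negP => /dimvS/leq_trans/(_ (dim_add_lines _ _)).
      by rewrite dM => /(leq_trans kr1); rewrite ltnS leqNgt k_gt1.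
    have [v [vM vU vxp]] := exists_notin2 MU Mxp.
    have dxv : (\dim (<[x]> + <[v]>) <= k)%N.
      exact: leq_trans (dim_add_lines _ _) k_gt1.
    have pxv : p \in (<[x]> + <[v]>)%VS -> p = 0.
      case/memv_addP=> _ /vlineP[s1 ->] [_ /vlineP[s2 ->] pE].
      have [s20|s20] := eqVneq s2 0.
        by case/negP: pU; rewrite pE s20 scale0r addr0 rpredZ.
      case/negP: vxp; have -> : v = (- s2^-1 * s1) *: x + s2^-1 *: p.
        by rewrite pE scalerDr !scalerA mulVf // scale1r addrA mulNr -scalerDl addNr scale0r add0r.
      by rewrite memv_add ?memvZ ?memv_line.
    have [||||K' [xvK KM' dK' pK' _]] :=
      @exists_subspace_avoiding _ _ M (<[x]> + <[v]>)%VS k p p.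
    + by rewrite subv_add -!memvE xM.
    + by rewrite dxv dM kr1.
    + exact: pxv.
    + exact: pxv.
    have xK' : (y <= K')%VS by rewrite yE; apply: subv_trans xvK; apply: addvSl.
    have vK' : v \in K' by apply: (subvP xvK); rewrite (subvP (addvSr _ _)) ?memv_line.
    have := fU K' KM' dK'; rewrite fST ?KMD // (orS K' y) //=.
    have -> : (K' <= U)%VS = false by apply/negP => /subvP/(_ v vK'); rewrite (negbTE vU).
    by move=> /esym/negbFE/pK'/eqP; rewrite (negbTE p0).
  - by case/andP=> HN' _; case/negP: N0; apply/existsP; exists H.
  by case/andP=> yT _; case/negP: T0; apply/existsP; exists y.
(* If [f] is the disjunction itself, no k-space of [M :&: U] may satisfy it. As this space has
   dimension above [k], a member of [N] or [T] would yield such a k-space. *)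
exfalso.
have pMK K : (K <= M)%VS -> (K <= U)%VS -> \dim K = k -> polar_or S N T K -> False.
  by move=> KM KU dK; rewrite -fST ?KMD // fU // KU.
have [/existsP[H HN']|N0] := boolP [exists H, H \in N].
  have [HW dH] := HN H HN'; pose A := (M :&: U :&: (M :&: H))%VS.
  have dA : (k <= \dim A)%N.
    rewrite -ltnS (leq_trans kMU) //; apply: (dim_cap_codim1 (capvSl M U) (capvSl M H)).
    by apply: (dim_cap_codim1 MW HW); rewrite dH.
  have [|K [_ KA dK]] := @exists_subspace_between _ _ A 0%VS k (sub0v _).
    by rewrite dimv0.
  move: KA; rewrite !subv_cap => /andP[/andP[KM KU] /andP[_ KH]].
  exact: (pMK K KM KU dK (orN K H HN' KH)).
have [/existsP[y yT]|T0] := boolP [exists y : {vspace V}, y \in T].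
  have [yi dy] := HT y yT; have [x x0 yE] := pt y dy.
  have [xM|xM] := boolP (x \in M).
    have [|||K [_ KA dK xK _]] := @exists_subspace_avoiding _ _ (M :&: U)%VS 0%VS k x x (sub0v _).
    - by rewrite dimv0.
    - by rewrite memv0 => /eqP.
    - by rewrite memv0 => /eqP.
    move: KA; rewrite subv_cap => /andP[KM KU].
    apply: (pMK K KM KU dK (orT K y yT _ _)).
      apply/subvP => z /(subvP KM) zM; rewrite yE mem_perp1.
      by rewrite (isotropic_bil Mi zM xM) eqxx.
    by rewrite yE -memvE; apply/negP => /xK/eqP; rewrite (negbTE x0).
  have [|K [_ KA dK]] := @exists_subspace_between _ _ (M :&: U :&: perp phi y)%VS 0%VS k (sub0v _).
    by rewrite dimv0 /= -ltnS (leq_trans kMU) // yE dim_cap_perp1.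
  move: KA; rewrite !subv_cap => /andP[/andP[KM KU] Ky].
  apply: (pMK K KM KU dK (orT K y yT Ky _)).
  by apply: contra xM => yK; rewrite memvE -yE (subv_trans yK).
(* With points only, a k-space where [f] is 1 contains a point of [S]; a k-space of [M] through that
   point and [p] contradicts [fU]. *)
have MU : ~~ (M <= U)%VS by apply/negP => /subvP/(_ p pM); rewrite (negbTE pU).
have Mp : ~~ (M <= <[p]>)%VS.
  apply/negP => /dimvS; rewrite dim_line // dM => /(leq_trans kr1).
  by rewrite ltnS leqNgt k_gt0.
have [v [vM vU vp]] := exists_notin2 MU Mp.
have v0 : v != 0 by apply: contraNneq vU => ->; rewrite mem0v.
have pv : p \in <[v]>%VS -> p = 0.
  by move=> pv; case/negP: vp; apply: vline_sym pv.
have [|||//|K [vK KM dK pK _]] := @exists_subspace_avoiding _ _ M <[v]>%VS k p p.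
- by rewrite -memvE.
- by rewrite dim_line // k_gt0 dM.
- exact: pv.
have fK : f K.
  rewrite fU //; apply/andP; split; last by apply: contra p0 => /pK ->.
  by apply/negP => /subvP/(_ v); rewrite memvE vK (negbTE vU) => /(_ isT).
move: fK; rewrite fST ?KMD // => /or3P[|/existsP[H]|/existsP[y]]; last first.
- by case/andP=> yT _; case/negP: T0; apply/existsP; exists y.
- by case/andP=> HN' _; case/negP: N0; apply/existsP; exists H.
case/existsP=> y /andP[yS yK]; have [_ /pt[x x0 yE]] := HS y yS.
have xM : x \in M by rewrite memvE -yE (subv_trans yK).
have [||K' [xpK KM' dK']] := @exists_subspace_between _ _ M (<[x]> + <[p]>)%VS k.
- by rewrite subv_add -!memvE xM.
- by rewrite (leq_trans (dim_add_lines _ _) k_gt1) dM /= ltnW.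
have : f K' by rewrite fST ?KMD // (orS K' y) // yE; apply: subv_trans xpK; apply: addvSl.
rewrite fU // => /andP[_ /negP]; apply.
by apply: (subvP xpK); rewrite (subvP (addvSr _ _)) ?memv_line.
Qed.

End WeightedPolarSpace.

(** * Transport along linear embeddings *)

Section Embedding.
Variables (F : finFieldType) (m d : nat).
Local Notation V := 'rV[F]_d.
Local Notation V' := 'rV[F]_m.

Lemma exists_embedding (U : {vspace V}) : \dim U = m ->
  exists emb : 'Hom(V', V), lker emb = 0%VS /\ limg emb = U.
Proof.
move=> dU; have dU' : m = \dim U by [].
pose bas i := (vbasis U)`_(i : nat).
pose g (r : V') : V := \sum_(i < m) r 0 i *: bas i.
have g_lin : linear g.
  move=> s x y; rewrite /g scaler_sumr -big_split /=; apply: eq_bigr => i _.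
  by rewrite !mxE scalerDl scalerA.
pose gL := GRing.isLinear.Build F V' V *:%R g g_lin.
pose gl : {linear V' -> V} := HB.pack g gL.
have gE r : linfun gl r = g r by rewrite lfunE.
have fr := basis_free (vbasisP U).
exists (linfun gl); split.
  apply/eqP; rewrite -subv0; apply/subvP => r; rewrite memv_ker gE memv0 => /eqP g0.
  apply/eqP/rowP => i; rewrite mxE.
  move/freeP: fr => /(_ (fun j => r 0 (cast_ord (esym dU') j))) fr.
  have := fr _ (cast_ord dU' i); rewrite cast_ordK; apply.
  rewrite -[RHS]g0 /g (reindex (cast_ord dU')) /=; last first.
    by exists (cast_ord (esym dU')) => j _; rewrite ?cast_ordK ?cast_ordKV.
  by apply: eq_bigr => j _; rewrite cast_ordK.
apply/eqP; rewrite eqEsubv; apply/andP; split; apply/subvP => v.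
  case/memv_imgP=> r _ ->; rewrite gE rpred_sum // => i _; rewrite rpredZ //.
  by rewrite vbasis_mem // mem_nth // size_tuple dU ltn_ord.
move=> /coord_vbasis ->; apply/memv_imgP.
exists (\row_j coord (vbasis U) (cast_ord dU' j) v); first exact: memvf.
rewrite gE /g (reindex (cast_ord dU')) /=; last first.
  by exists (cast_ord (esym dU')) => j _; rewrite ?cast_ordK ?cast_ordKV.
by apply: eq_bigr => j _; rewrite mxE.
Qed.

Variables (emb : 'Hom(V', V)).
Hypothesis emb_inj : lker emb = 0%VS.
Implicit Types (K U : {vspace V'}).

Lemma embI : injective emb.
Proof. by apply/lker0P; rewrite emb_inj. Qed.

Lemma mem_emb K v : (emb v \in (emb @: K)%VS) = (v \in K).
Proof.
apply/idP/idP => [/memv_imgP[u uK /embI -> //]|vK]; exact: memv_img.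
Qed.

Lemma sub_emb K U : (emb @: K <= emb @: U)%VS = (K <= U)%VS.
Proof.
apply/idP/idP => [/subvP KU|/limgS //]; apply/subvP => v vK.
by rewrite -mem_emb KU // mem_emb.
Qed.

Lemma dim_emb K : \dim (emb @: K) = \dim K.
Proof. by rewrite limg_dim_eq // emb_inj capv0. Qed.

Lemma emb_preim (K : {vspace V}) : (K <= limg emb)%VS -> (emb @: (emb @^-1: K))%VS = K.
Proof. exact: lpreimK. Qed.

Lemma vsum_emb (R : realFieldType) (w : V -> R) K :
  vsum w (emb @: K)%VS = vsum (w \o emb) K.
Proof.
rewrite /vsum; pose A := [set v | v \in K].
rewrite (eq_bigl (mem [set emb v | v in A])); last first.
  move=> x; apply/memv_imgP/imsetP => [[v vK ->]|[v]]; first by exists v; rewrite ?inE.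
  by rewrite inE => vK ->; exists v.
rewrite big_imset /=; last by move=> x y _ _; apply: embI.
by apply: eq_bigl => x; rewrite inE.
Qed.

Lemma zero_shape_ext (k : nat) (f g : {vspace V} -> bool) (M : {vspace V}) : f =1 g ->
  zero_shape k f M -> zero_shape k g M.
Proof.
move=> fg [[p fE]|[U [p [pU dM fE]]]]; [left | right].
  by exists p => K KM dK; rewrite -fg fE.
by exists U, p; split=> // K KM dK; rewrite -fg fE.
Qed.

(** The Grassmann hypothesis is applied to [f] pulled back along [emb], and the resulting point and
    hyperplane are pushed forward into [M]. *)
Lemma zero_shape_grassmann (R : realType) (k : nat) (w : V -> R)
    (f : {vspace V} -> bool) (M : {vspace V}) :
    all_grassmann_trivial R F m k -> limg emb = M -> w 0 = 0 ->
    (forall K : {vspace V}, (K <= M)%VS -> \dim K = k -> (f K)%:R = vsum w K) ->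
  zero_shape k f M \/ zero_shape k (fun K : {vspace V} => ~~ f K) M.
Proof.
move=> triv iM w0 fE.
have iKM K : (emb @: K <= M)%VS by rewrite -iM limgS // subvf.
have dM : \dim M = m by rewrite -iM dim_emb dimvf /dim /= mul1n.
pose f' K := f (emb @: K)%VS.
have : boolean_degree1 R (grassmannian V' k) (all_points V') f'.
  apply: (@weights_degree1 _ _ _ _ _ _ (w \o emb)) => [|p|K _ p|K].
  - by rewrite /= linear0.
  - by rewrite inE => /eqP.
  - by rewrite inE => ->.
  by rewrite inE => /eqP dK; rewrite /f' fE ?dim_emb // vsum_emb.
move/triv; have pick_point (p : {vspace V'}) : p \in all_points V' ->
    exists x, [/\ x \in M, x \notin (emb @: 0)%VS & forall K,
      through x (emb @: K)%VS = (p <= K)%VS /\ ((x \in (emb @: K)%VS) = (p <= K)%VS)].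
  rewrite inE => /eqP dp; have p0 : p != 0%VS by rewrite -dimv_eq0 dp.
  have pE : (p = <[vpick p]>)%VS.
    by apply/esym/eqP; rewrite eqEdim -memvE memv_pick dim_line ?vpick0 // dp.
  have x0 : emb (vpick p) != 0 by rewrite -(linear0 emb) (inj_eq embI) vpick0.
  exists (emb (vpick p)); split.
  - by rewrite -iM memv_img // memvf.
  - by rewrite limg0 memv0.
  by move=> K; rewrite /through x0 /= mem_emb memvE -pE.
(* p^+ is of zero shape itself; for 1, pi^+ and p^+ \/ pi^+ the complement is. *)
have main (h : {vspace V} -> bool) (g : {vspace V'} -> bool) :
    {in grassmannian V' k, forall K, h (emb @: K)%VS = g K} ->
    [\/ g =1 xpredT, exists2 p, p \in all_points V' & g =1 pointf p,
      exists2 H, H \in hyperplanes V' & g =1 hyperf H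
      | exists p H, [/\ p \in all_points V', H \in hyperplanes V', ~~ (p <= H)%VS
         & g =1 (fun K => pointf p K || hyperf H K)]] ->
    zero_shape k h M \/ zero_shape k (fun K : {vspace V} => ~~ h K) M.
  move=> hg; have hgK (K : {vspace V}) : (K <= M)%VS -> \dim K = k -> exists2 K' : {vspace V'},
      K = (emb @: K')%VS & h K = g K'.
    move=> KM dK; have KE : K = (emb @: (emb @^-1: K))%VS by rewrite emb_preim // iM.
    exists (emb @^-1: K)%VS => //; rewrite [in LHS]KE hg // inE -dim_emb -KE.
    exact/eqP.
  have hypd (H : {vspace V'}) : H \in hyperplanes V' ->
      (\dim M <= (\dim (M :&: emb @: H)).+1)%N.
    rewrite inE (capv_idPr (iKM H)) dim_emb dM => /eqP ->.
    by rewrite dimvf /dim /= mul1n.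
  case=> [gE|[p /pick_point[x [xM x0 xE]] gE]|[H HH gE]|[p [H [pp HH pH gE]]]].
  - right; left; exists 0 => K KM dK; have [K' _ ->] := hgK K KM dK.
    by rewrite gE /through eqxx.
  - left; left; exists x => K KM dK; have [K' -> ->] := hgK K KM dK.
    by rewrite gE (xE K').1.
  - right; right; exists (emb @: H)%VS, 0; split=> //; first exact: hypd.
    move=> K KM dK; have [K' -> ->] := hgK K KM dK.
    by rewrite gE /through eqxx andbT sub_emb.
  have [x [xM x0 xE]] := pick_point p pp.
  right; right; exists (emb @: H)%VS, x; split; last 1 first.
  - move=> K KM dK; have [K' -> ->] := hgK K KM dK.
    by rewrite gE (xE K').1 sub_emb negb_or andbC.
  - by rewrite (xE H).2 (negbTE pH).
  exact: hypd.
have post (g : {vspace V'} -> bool) : eq_upto_compl (grassmannian V' k) f' g ->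
    [\/ g =1 xpredT, exists2 p, p \in all_points V' & g =1 pointf p,
      exists2 H, H \in hyperplanes V' & g =1 hyperf H
      | exists p H, [/\ p \in all_points V', H \in hyperplanes V', ~~ (p <= H)%VS
         & g =1 (fun K => pointf p K || hyperf H K)]] ->
    zero_shape k f M \/ zero_shape k (fun K : {vspace V} => ~~ f K) M.
  case=> fg /(main _ g) H; first exact: H.
  case: (H (fun K : {vspace V} => ~~ f K)) => [K KD|sh|sh]; last 2 first.
  - by right.
  - by left; apply: zero_shape_ext sh => K; rewrite negbK.
  by rewrite -/(f' K) fg // negbK.
case=> [E|[p pp E]|[H HH E]|[p [H [pp HH pH E]]]]; apply: (post _ E).
- by constructor 1.
- by constructor 2; exists p.
- by constructor 3; exists H.
by constructor 4; exists p, H.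
Qed.

End Embedding.

(** * Restriction of the form to an embedded subspace *)

Section Pullback.
Variables (F : finFieldType) (m d : nat) (eps : bool) (theta : {rmorphism F -> F}).
Variables (B : {hermitian 'rV[F]_d for eps & theta}) (emb : 'Hom('rV[F]_m, 'rV[F]_d)).

Definition pullback (u v : 'rV[F]_m) : F := B (emb u) (emb v).

Fact pullback_bilinear : bilinear_for
  (GRing.Scale.Law.clone _ _ *%R _) (GRing.Scale.Law.clone _ _ (theta \; *%R) _) pullback.
Proof.
split=> [u'|u] a x y; rewrite /pullback linearP /=.
  by rewrite linearDl linearZl_LR.
by rewrite linearDr linearZr_LR.
Qed.

HB.instance Definition _ := bilinear_isBilinear.Build F 'rV[F]_m 'rV[F]_m F
  _ _ pullback pullback_bilinear.

Fact pullback_hermitian u v : pullback u v = (-1) ^+ eps * theta (pullback v u).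
Proof. exact: hermC. Qed.

HB.instance Definition _ :=
  isHermitianSesquilinear.Build F 'rV[F]_m eps theta pullback pullback_hermitian.

End Pullback.

Section PullbackForm.
Variables (F : finFieldType) (m d : nat) (phi : classical_form F d).
Variable emb : 'Hom('rV[F]_m, 'rV[F]_d).
Local Notation V := 'rV[F]_d.
Local Notation V' := 'rV[F]_m.
Implicit Types (K U : {vspace V'}).

Definition pullback_form : classical_form F m :=
  match phi with
  | Orthogonal B Q => Orthogonal (pullback B emb : {symmetric V'}) (Q \o emb)
  | Symplectic B => Symplectic (pullback B emb : {skew_symmetric V'})
  | Unitary th B => Unitary (pullback B emb : {hermitian_sym V' for th})
  end.

Lemma bil_pullback u v : bil pullback_form u v = bil phi (emb u) (emb v).
Proof. by rewrite /bil /pullback_form; case: phi. Qed.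

Lemma sing_pullback v : sing pullback_form v = sing phi (emb v).
Proof. by rewrite /sing /pullback_form; case: phi. Qed.

Lemma isotropic_pullback U : isotropic pullback_form U = isotropic phi (emb @: U).
Proof.
apply/isotropicP/isotropicP => -[Us UU]; split.
- by move=> _ /memv_imgP[v vU ->]; rewrite -sing_pullback Us.
- move=> _ _ /memv_imgP[u uU ->] /memv_imgP[v vU ->].
  by rewrite -bil_pullback UU.
- by move=> v vU; rewrite sing_pullback Us // memv_img.
by move=> u v uU vU; rewrite bil_pullback UU // memv_img.
Qed.

Lemma sub_perp_pullback K U :
  (emb @: K <= perp phi (emb @: U))%VS = (K <= perp pullback_form U)%VS.
Proof.
apply/subvP/subvP => KU.
  move=> u uK; apply/mem_perpP => v vU; rewrite bil_pullback.
  by apply: (mem_perpP _ _ _ (KU _ (memv_img _ uK))); apply: memv_img.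
move=> _ /memv_imgP[u uK ->]; apply/mem_perpP => _ /memv_imgP[v vU ->].
by rewrite -bil_pullback; apply: (mem_perpP _ _ _ (KU _ uK)).
Qed.

Hypothesis emb_inj : lker emb = 0%VS.
Variables (e : polar_type) (n : nat).
Hypothesis phiP : form_of_type e phi.
Hypothesis PW : polar_on phi (limg emb) n.

Lemma pullback_radical v : (forall u, bil pullback_form v u = 0) ->
  sing pullback_form v -> v = 0.
Proof.
move=> vr sv; apply: (embI emb_inj); rewrite linear0; apply: PW.1.
- by rewrite memv_img // memvf.
- by rewrite -sing_pullback.
by move=> _ /memv_imgP[u _ ->]; apply: bil_sym0; rewrite -bil_pullback.
Qed.

(** Nondegeneracy comes from [pullback_radical], which concerns singular vectors; in the symplectic
    and unitary cases every radical vector is singular. *)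
Lemma pullback_of_type : form_of_type e pullback_form.
Proof.
move: phiP pullback_radical.
rewrite /form_of_type /bil /sing /pullback_form; case: phi => [B Q|B|th B] H rad.
- suff Q' : nondegenerate_quadratic (pullback B emb : {symmetric V'}) (Q \o emb).
    by case: e H.
  have [QZ QD Qnd] : nondegenerate_quadratic B Q by case: e H.
  split=> [a v|u v|v /mem_orthovP vr Qv] /=.
  + by rewrite linearZ QZ.
  + by rewrite linearD QD.
  by apply: rad => [u|]; [apply: vr; rewrite memvf | apply/eqP].
- suff B' : is_psymplectic (pullback B emb : {skew_symmetric V'}) by case: e H.
  have [_ _ alt] : is_psymplectic B by case: e H.
  split=> [||c2 u]; last exact: alt.
    rewrite /nondegenerate -subv0; apply/subvP => v /mem_orthovP vr.
    by rewrite memv0; apply/eqP/rad => // u; apply: vr; rewrite memvf.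
  by split.
suff B' : [/\ involutive th, ~ th =1 id & is_unitary (pullback B emb : {hermitian_sym V' for th})].
  by case: e H.
have [thK thN _] : [/\ involutive th, ~ th =1 id & is_unitary B] by case: e H.
split=> //; split=> //; rewrite /nondegenerate -subv0; apply/subvP => v /mem_orthovP vr.
rewrite memv0; apply/eqP/rad => [u|]; first by apply: vr; rewrite memvf.
by apply/eqP; apply: vr; rewrite memvf.
Qed.

Lemma pullback_rank :
    (forall M, isotropic phi M -> (M <= limg emb)%VS -> \dim M <= n)%N ->
  polar_rank pullback_form = n.
Proof.
move=> rk; apply/eqP; rewrite eqn_leq; apply/andP; split.
  apply/bigmax_leqP => U Ui; rewrite -(dim_emb emb_inj); apply: rk.
    by rewrite -isotropic_pullback.
  by rewrite limgS // subvf.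
have [M [Mi MW dM]] := PW.2; have ME := emb_preim MW.
rewrite -dM -ME dim_emb //; apply: (@leq_bigmax_cond _ _ (fun U : {vspace V'} => \dim U)).
by rewrite isotropic_pullback ME.
Qed.

Lemma exists_in_imset (S : {set {vspace V'}}) (P : {vspace V} -> bool) :
  [exists p in [set (emb @: x)%VS | x in S], P p] = [exists p in S, P (emb @: p)%VS].
Proof.
apply/existsP/existsP => [[_ /andP[/imsetP[p pS ->] Pp]]|[p /andP[pS Pp]]].
  by exists p; rewrite pS.
by exists (emb @: p)%VS; rewrite imset_f.
Qed.

Lemma polar_trivial_pullback (R : realType) (k : nat) (w : V -> R) (f : {vspace V} -> bool) :
    w 0 = 0 ->
    (forall K : {vspace V}, isotropic phi K -> \dim K = k -> (f K)%:R = vsum w K) ->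
    (forall f' : {vspace V'} -> bool,
       boolean_degree1 R (isotropic_spaces pullback_form k)
         (isotropic_points pullback_form) f' ->
       polar_trivial pullback_form (isotropic_spaces pullback_form k) f') ->
  polar_trivial_on k phi f (limg emb).
Proof.
move=> w0 fE triv; have := triv (fun K => f (emb @: K)%VS); case.
  apply: (@weights_degree1 _ _ _ _ _ _ (w \o emb)) => [|p|K|K].
  - by rewrite /= linear0.
  - by rewrite inE => /andP[_ /eqP].
  - rewrite inE => /andP[Ki _] p dp pK; rewrite inE dp eqxx andbT.
    exact: isotropicS Ki.
  rewrite inE isotropic_pullback => /andP[Ki /eqP dK].
  by rewrite -(vsum_emb emb_inj) fE // dim_emb.
move=> S [N [T [SI NH TI fST]]].
pose im (A : {set {vspace V'}}) := [set (emb @: x)%VS | x in A].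
have points (A : {set {vspace V'}}) : A \subset isotropic_points pullback_form ->
    {in im A, forall p : {vspace V}, isotropic phi p /\ \dim p = 1%N}.
  move=> /subsetP AI _ /imsetP[p /AI pI ->]; move: pI.
  by rewrite inE isotropic_pullback dim_emb // => /andP[-> /eqP ->].
have orE K : polar_or phi (im S) (im N) (im T) (emb @: K)%VS =
    [|| [exists p in S, pointf p K], [exists H in N, hyperf H K]
      | [exists p in T, hyperf (perp pullback_form p) K && ~~ pointf p K]].
  rewrite /polar_or !exists_in_imset /pointf /hyperf.
  congr [|| _, _ | _]; apply: eq_existsb => p; rewrite ?sub_emb //.
  by rewrite sub_perp_pullback.
exists (im S), (im N), (im T); split; [exact: points| |exact: points|].
  move=> _ /imsetP[H /NH /andP[+ _] ->]; rewrite inE !dim_emb // => /eqP ->.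
  by rewrite limgS ?subvf.
have embK (K : {vspace V}) :
    K \in [set K | [&& isotropic phi K, \dim K == k & (K <= limg emb)%VS]] ->
    exists2 K' : {vspace V'}, K' \in isotropic_spaces pullback_form k & K = (emb @: K')%VS.
  rewrite inE => /and3P[Ki dK /emb_preim KE].
  exists (emb @^-1: K)%VS; last by rewrite KE.
  by rewrite inE isotropic_pullback -(dim_emb emb_inj) KE Ki.
case: fST => fST; [left | right] => K /embK[K' K'I ->]; first by rewrite orE fST.
by rewrite orE fST.
Qed.

End PullbackForm.

(** * Rank n + 1 *)

Section Assembly.
Variables (R : realType) (F : finFieldType) (d k n : nat) (phi : classical_form F d).
Variable e : polar_type.
Hypothesis phiP : form_of_type e phi.
Hypothesis k_gt1 : (1 < k)%N.
Hypothesis kn : (k.+2 <= n)%N.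
Local Notation V := 'rV[F]_d.
Hypothesis PV : polar_on phi fullv n.+1.
Local Notation bil := (bil phi).
Local Notation sing := (sing phi).
Local Notation o := (wpoint R F).
Local Notation t := (waffine R F k).
Local Notation u := (wunit R F k).
Implicit Types (H K M U W Y : {vspace V}) (p v x y z : V).
Implicit Types (w : V -> R) (f : {vspace V} -> bool).

Let k_gt0 : (0 < k)%N := ltnW k_gt1.
Let kn1 : (k < n.+1)%N := ltnW (ltnW kn).

Definition homogeneous w : Prop := forall (a : F) v, a != 0 -> w (a *: v) = w v.

Definition weighs w f : Prop :=
  forall K, isotropic phi K -> \dim K = k -> (f K)%:R = vsum w K.

Definition generator M : Prop := isotropic phi M /\ \dim M = n.+1.

Lemma extend_generator K : isotropic phi K -> (\dim K <= n.+1)%N ->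
  exists2 M, generator M & (K <= M)%VS.
Proof.
move=> Ki dK; have [M [Mi KM _ dM]] := polar_extend phiP PV Ki (subvf _) dK.
by exists M.
Qed.

Lemma orthogonal_generator x y : sing x -> sing y -> bil x y = 0 ->
  exists M, [/\ generator M, x \in M & y \in M].
Proof.
move=> sx sy xy; have [||M gM xyM] := @extend_generator (<[x]> + <[y]>)%VS.
- apply: (isotropic_add_line phiP (isotropic_line phiP sx) sy).
  by move=> _ /vlineP[s ->]; rewrite bilZl xy mulr0.
- by rewrite (leq_trans (dim_add_lines _ _)) // (leq_trans k_gt1) // ltnW.
exists M; split=> //; rewrite memvE (subv_trans _ xyM) //; [exact: addvSl | exact: addvSr].
Qed.

(** The weight of [~~ f]: the constant 1 is spread over the nonzero vectors of a k-space. *)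
Definition compl_weight w v : R := (v != 0)%:R * u - w v.

Lemma compl_weight_homogeneous w : homogeneous w -> homogeneous (compl_weight w).
Proof.
by move=> wZ a v a0; rewrite /compl_weight wZ // scaler_eq0 (negbTE a0).
Qed.

Lemma compl_weighs w f : weighs w f -> weighs (compl_weight w) (fun K => ~~ f K).
Proof.
move=> fE K Ki dK; rewrite /vsum sumrB -/(vsum w K) -fE //.
have -> : \sum_(v in K) (v != 0)%:R * u = 1.
  pose h v : R := (v != 0)%:R * u.
  have hE : vsum h K - vsum h 0%VS = u * (#|F|%:R ^+ \dim K - #|F|%:R ^+ \dim (0%VS : {vspace V})).
    apply: vsum_const; first exact: sub0v.
    by move=> v _; rewrite memv0 /h => ->; rewrite mul1r.
  rewrite -[LHS]/(vsum h K); move: hE; rewrite vsum0 /h eqxx mul0r subr0 dK dimv0 => ->.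
  by rewrite /wunit mulVf // subr_eq0 gt_eqF // exprn_egt1 ?q_gt1 // -lt0n.
by case: (f K); rewrite ?subrr ?subr0.
Qed.

(* Collinear points lie in a common generator, and the weights occurring in the two
   alternatives are different, so that the alternative propagates to all generators. *)
Lemma zero_type_uniform w f : w 0 = 0 -> homogeneous w -> weighs w f ->
    (forall M, generator M -> zero_shape k f M \/ zero_shape k (fun K => ~~ f K) M) ->
  (forall M, generator M -> zero_type k w M) \/
  (forall M, generator M -> zero_type k (compl_weight w) M).
Proof.
move=> w0 wZ fE shape.
have c0 : compl_weight w 0 = 0 by rewrite /compl_weight eqxx mul0r w0 subrr.
have cZ := compl_weight_homogeneous wZ; have cE := compl_weighs fE.
have types M : generator M -> zero_type k w M \/ zero_type k (compl_weight w) M.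
  move=> gM; have [Mi dM] := gM; have [sh|sh] := shape M gM; [left | right].
    apply: (zero_shape_type k_gt0 w0 wZ _ sh); first by rewrite dM.
    by move=> K KM dK; apply: fE => //; apply: isotropicS Mi.
  apply: (zero_shape_type k_gt0 c0 cZ _ sh); first by rewrite dM.
  by move=> K KM dK; apply: cE => //; apply: isotropicS Mi.
have conflict v M M' : v != 0 -> v \in M -> v \in M' ->
    zero_type k w M -> zero_type k (compl_weight w) M' -> False.
  move=> v0 vM vM' wM cM'; apply: (zero_type_compl k_gt1 wM cM' vM vM').
  by rewrite /compl_weight v0 mul1r addrC subrK.
(* Two generators are linked by a third one: [v'] is taken in [M'] orthogonal to [v] in [M], and
   [M2] contains both. *)
have meet M M' : generator M -> generator M' -> exists M2 v v',
    [/\ generator M2, v != 0, v \in M & v \in M2] /\ [/\ v' != 0, v' \in M' & v' \in M2].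
  move=> [Mi dM] [M'i dM']; pose v := vpick M; have vM : v \in M := memv_pick _.
  have v0 : v != 0 by rewrite vpick0 -dimv_eq0 dM.
  pose A := (M' :&: perp phi <[v]>)%VS; pose v' := vpick A.
  have v'0 : v' != 0.
    rewrite vpick0 -dimv_eq0 -lt0n -ltnS (leq_trans _ (dim_cap_perp1 _ _ _)) // dM' ltnS.
    exact: leq_trans kn.
  have := memv_pick A; rewrite -/v' memv_cap mem_perp1 => /andP[v'M' /eqP v'v].
  have [M2 [gM2 v'M2 vM2]] :=
    orthogonal_generator (isotropic_sing M'i v'M') (isotropic_sing Mi vM) v'v.
  by exists M2, v, v'.
have [M0 gM0] : exists M, generator M.
  by have [_ [M [Mi _ dM]]] := PV; exists M.
case: (types M0 gM0) => t0; [left | right] => M gM; case: (types M gM) => // tM.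
  have [M2 [v [v' [[gM2 v0 vM vM2] [v'0 v'M' v'M2]]]]] := meet M0 M gM0 gM.
  by case: (types M2 gM2) => t2; [case: (conflict v' M2 M) | case: (conflict v M0 M2)].
have [M2 [v [v' [[gM2 v0 vM vM2] [v'0 v'M' v'M2]]]]] := meet M0 M gM0 gM.
by case: (types M2 gM2) => t2; [case: (conflict v M2 M0) | case: (conflict v' M M2)].
Qed.

Variables (w : V -> R) (f : {vspace V} -> bool).
Hypotheses (w0 : w 0 = 0) (wZ : homogeneous w) (fE : weighs w f).
Hypothesis wM : forall M, generator M -> zero_type k w M.

Lemma isotropic_zero_type K : isotropic phi K -> (\dim K <= n.+1)%N -> zero_type k w K.
Proof. by move=> Ki dK; have [M gM KM] := extend_generator Ki dK; apply: zero_typeS (wM gM). Qed.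

Lemma hweight_subspace M : generator M -> exists U, {in M, forall v, hweight w v = (v \in U)} /\
  (\dim M <= (\dim (M :&: U)).+1)%N.
Proof.
move=> gM; case: (wM gM) => [[p wE]|[U [p [pU dM wE]]]].
  exists fullv; split=> [v vM|]; last by rewrite capvf.
  by rewrite memvf (point_weight_hweight (wE v vM)).
by exists U; split=> // v vM; rewrite (affine_weight_hweight k_gt1 (wE v vM)).
Qed.

Lemma hweightZ (s : F) x : sing x -> hweight w x -> hweight w (s *: x).
Proof.
move=> _; have [->|s0] := eqVneq s 0; first by rewrite scale0r /hweight w0 eqxx.
by rewrite /hweight wZ.
Qed.

Lemma hweightD x y : sing x -> sing y -> bil x y = 0 ->
  hweight w x -> hweight w y -> hweight w (x + y).
Proof.
move=> sx sy xy; have [M [gM xM yM]] := orthogonal_generator sx sy xy.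
have [U [XU _]] := hweight_subspace gM.
by rewrite (XU _ xM) (XU _ yM) (XU _ (rpredD xM yM)) => xU yU; apply: rpredD.
Qed.

(** In a generator through [p] and [x], the vectors of weight 0 or o form a hyperplane that misses
    [p]. *)
Lemma hweight_project p x : sing p -> ~~ hweight w p -> sing x -> bil x p = 0 ->
  exists s, hweight w (x - s *: p).
Proof.
move=> sp pX sx xp; have [M [gM xM pM]] := orthogonal_generator sx sp xp.
have [U [XU dU]] := hweight_subspace gM.
have pU : p \notin (M :&: U)%VS by rewrite memv_cap -XU // (negbTE pX) andbF.
have : x \in (M :&: U + <[p]>)%VS.
  have /eqP -> // : (M :&: U + <[p]> == M)%VS.
  by rewrite eqEdim subv_add capvSl -memvE pM dim_add_line_notin.
case/memv_addP=> y; rewrite memv_cap => /andP[yM yU] [_ /vlineP[s ->] xE].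
by exists s; rewrite xE addrK XU.
Qed.

Lemma w_vpick x : w (vpick <[x]>%VS) = w x.
Proof.
have /vlineP[s sE] := memv_pick <[x]>%VS.
have [x0|x0] := eqVneq x 0; first by rewrite sE x0 scaler0.
rewrite sE wZ //; apply: contraNneq x0 => s0; move: sE; rewrite s0 scale0r => /eqP.
by rewrite vpick0 -dimv_eq0 dim_vline; case: (x == 0).
Qed.

Definition weight_points (c : R) : {set {vspace V}} :=
  [set p in isotropic_points phi | w (vpick p) == c].

Lemma exists_weight_point c K : c != 0 -> isotropic phi K ->
  [exists p in weight_points c, pointf p K] = [exists v, (v \in K) && (w v == c)].
Proof.
move=> c0 Ki; apply/existsP/existsP => [[p /andP[]]|[v /andP[vK /eqP wv]]].
  rewrite !inE => /andP[_ wp] pK; exists (vpick p).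
  by rewrite wp andbT (subvP pK) // memv_pick.
have v0 : v != 0 by apply: contraNneq c0 => v0; rewrite -wv v0 w0.
have vK' : (<[v]> <= K)%VS by rewrite -memvE.
by exists <[v]>%VS; rewrite !inE (isotropicS vK') // dim_line // w_vpick wv !eqxx.
Qed.

(** Without the value t - o all weights are nonnegative, so [f] is 1 exactly on the k-spaces with a
    point of positive weight. *)
Lemma polar_trivial_nonneg : (forall v, sing v -> w v != t - o) ->
  polar_trivial phi (isotropic_spaces phi k) f.
Proof.
move=> wn; pose S := [set p in isotropic_points phi | 0 < w (vpick p)].
exists S, set0, set0; split.
- by apply/subsetP => p; rewrite inE => /andP[].
- by move=> H; rewrite inE.
- exact: sub0set.
left=> K; rewrite inE => /andP[Ki /eqP dK].
have [u0 ut to o0] := weight_order R F k_gt1.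
have w_ge0 v : v \in K -> 0 <= w v.
  move=> vK; have wK := isotropic_zero_type Ki (leq_trans (eq_leq dK) (ltnW kn1)).
  have [->|->|->|E] := zero_type_values wK vK; rewrite ?lexx //; try lra.
  by have := wn v (isotropic_sing Ki vK); rewrite E eqxx.
have -> : [exists H in (set0 : {set {vspace V}}), hyperf H K] = false.
  by apply/existsP => -[H]; rewrite inE.
have -> : [exists p in (set0 : {set {vspace V}}), hyperf (perp phi p) K && ~~ pointf p K] = false.
  by apply/existsP => -[H]; rewrite inE.
rewrite !orbF; apply/idP/existsP => [fK|[p /andP[]]].
  have [/existsP[v /andP[vK wv]]|] := boolP [exists v, (v \in K) && (0 < w v)].
    have v0 : v != 0 by apply: contraTneq wv => ->; rewrite w0 ltxx.
    have vK' : (<[v]> <= K)%VS by rewrite -memvE.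
    by exists <[v]>%VS; rewrite !inE (isotropicS vK') // dim_line // w_vpick eqxx wv.
  rewrite negb_exists => /forallP wK; have := fE Ki dK; rewrite fK /vsum big1 => [/eqP|v vK].
    by rewrite oner_eq0.
  by apply/eqP; rewrite eq_le w_ge0 // andbT; have := wK v; rewrite vK -leNgt.
rewrite inE => /andP[_ wp] pK; have pK' : vpick p \in K by rewrite (subvP pK) ?memv_pick.
have := fE Ki dK; rewrite /vsum (bigD1 (vpick p)) //=.
case: (f K) => //= /eqP; rewrite lt_eqF // ltr_wpDr //.
by apply: sumr_ge0 => v /andP[vK _]; apply: w_ge0.
Qed.

Hypothesis f_trivial : forall a b, sing a -> sing b -> bil a b != 0 ->
  polar_trivial_on k phi f (hperp phi fullv a b).

(** [geometric_hyperplane_glue] builds a hyperplane whose singular vectors have weight 0 or o, and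
    [geometric_hyperplane_maximal] shows that there are no others. *)
Lemma hweight_hyperplane p : sing p -> w p = t - o ->
  exists H, (\dim H).+1 = d /\ forall x, sing x -> hweight w x = (x \in H).
Proof.
move=> sp wp; have pX := not_hweight k_gt1 (or_intror wp).
have p0 : p != 0 by apply: contraNneq pX => ->; rewrite /hweight w0 eqxx.
have [r nE] : exists r, n = r.+2 by exists n.-2; move: kn; case: (n) => [|[|]].
have PV' : polar_on phi fullv r.+3 by rewrite -nE.
have [a' [b' [_ /andP[sa' sb'] a'p b'p ab']]] :=
  polar_hyperbolic_perp phiP PV' (memvf p) sp p0.
(* Moving [a'] and [b'] along [p] gives them weight 0 or o; they stay singular and hyperbolic, as
   [p] is singular and orthogonal to both. *)
have [sa Xa] := hweight_project sp pX sa' a'p; have [sb Xb] := hweight_project sp pX sb' b'p.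
pose a := a' - sa *: p; pose b := b' - sb *: p.
have a_sing : sing a by apply: (singB phiP) => //; [apply: (singZ phiP) | apply: bilZr0].
have b_sing : sing b by apply: (singB phiP) => //; [apply: (singZ phiP) | apply: bilZr0].
have pp := sing_bil phiP sp.
have ab : bil a b != 0.
  rewrite bilBl bilZl /b -scaleNr !bilDr (bilZr0 _ a'p) (bilZr0 _ pp).
  by rewrite (bil_sym0 b'p) !addr0 mulr0 subr0.
have ap : bil a p = 0 by rewrite bilBl bilZl a'p pp mulr0 subr0.
have bp : bil b p = 0 by rewrite bilBl bilZl b'p pp mulr0 subr0.
pose W := hperp phi fullv a b.
have pW : p \in W by rewrite mem_hperp memvf (bil_sym0 ap) (bil_sym0 bp) eqxx.
have PW : polar_on phi W n.
  by rewrite nE; apply: (polar_hperp phiP PV' (memvf a) (memvf b) a_sing b_sing ab).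
have wW M : isotropic phi M -> (M <= W)%VS -> \dim M = n -> zero_type k w M.
  by move=> Mi _ dM; apply: isotropic_zero_type; rewrite ?dM.
have [Y [YW Yhyp YX]] := polar_trivial_hyperplane phiP k_gt1 fE PW kn wW pW sp p0 wp
  (f_trivial a_sing b_sing ab).
have [H [pH dH HX]] := geometric_hyperplane_glue phiP hweightZ hweightD PV' a_sing b_sing ab
  Xa Xb sp p0 (negP pX) pW YW Yhyp YX.
exists H; split=> // x sx; apply/idP/idP => [xX|]; last by move/HX; apply.
apply: (geometric_hyperplane_maximal phiP hweightZ hweightD PV' _ HX sp (negP pX) sx xX).
move=> z v zH; have : v \in (H + <[z]>)%VS.
  have /eqP -> : (H + <[z]> == fullv)%VS; last exact: memvf.
  by rewrite eqEdim subvf dim_add_line_notin // dH dimvf /dim /= mul1n.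
by case/memv_addP=> y yH [_ /vlineP[s ->] ->]; exists s; rewrite addrK.
Qed.

(** Read off from the type of [K]. In the point alternative [K] lies in [H], and a vector of weight
    o marks the point. In the affine alternative [H] and [U] agree on [K], and a vector of weight t
    - o marks the point. *)
Lemma f_hyperplane H K : (forall x, sing x -> hweight w x = (x \in H)) ->
    isotropic phi K -> \dim K = k ->
  f K = if (K <= H)%VS then [exists v, (v \in K) && (w v == o)]
        else ~~ [exists v, (v \in K) && (w v == t - o)].
Proof.
move=> XH Ki dK; have [u0 ut to o0] := weight_order R F k_gt1.
have wK := isotropic_zero_type Ki (leq_trans (eq_leq dK) (ltnW kn1)).
have XHK v : v \in K -> hweight w v = (v \in H) by move=> /(isotropic_sing Ki)/XH.
case: wK => [[p wE]|[U [p [pU dU wE]]]].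
  have -> : (K <= H)%VS.
    by apply/subvP => v vK; rewrite -XHK // (point_weight_hweight (wE v vK)).
  have -> : f K = through p K.
    by apply: (@bool_natr_inj R); rewrite fE // (eq_vsum wE) vsum_point_weight.
  apply/idP/existsP => [/andP[p0 pK]|[v /andP[vK]]].
    by exists p; rewrite pK wE // /point_weight /through p0 memv_line mul1r eqxx.
  rewrite wE // /point_weight; case: (boolP (through _ _)) => [/andP[v0 vp] _|_]; last first.
    by rewrite mul0r lt_eqF.
  have p0 : p != 0.
    by apply: contraNneq v0 => p0; move: vp; rewrite p0 => /vlineP[s ->]; rewrite scaler0.
  by rewrite /through p0 /=; have := vline_sym v0 vp; apply: subvP; rewrite -memvE.
have HU v : v \in K -> (v \in H) = (v \in U).
  by move=> vK; rewrite -XHK // (affine_weight_hweight k_gt1 (wE v vK)).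
have -> : (K <= H)%VS = (K <= U)%VS.
  by apply/subvP/subvP => KU v vK; [rewrite -HU | rewrite HU] => //; apply: KU.
have -> : f K = ~~ (K <= U)%VS && ~~ through p K.
  apply: (@bool_natr_inj R); rewrite fE // -(vsum_affine_weight R k_gt0 pU dU (subvv K) dK).
  exact: eq_vsum.
case: (boolP (K <= U)%VS) => KU /=.
  apply/esym/negbTE/existsP => -[v /andP[vK]].
  by rewrite wE // /affine_weight (subvP KU) // mul0r lt_eqF.
congr (~~ _); apply/andP/existsP => [[p0 pK]|[v /andP[vK]]].
  exists p; rewrite pK wE // /affine_weight memv_line mul1r.
  by have -> : p \notin U; [apply: contra p0 => /pU -> | rewrite mul1r eqxx].
rewrite wE // /affine_weight; case: (boolP (v \in U)) => vU.
  by rewrite mul0r => /eqP; lra.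
have v0 : v != 0 by apply: contraNneq vU => ->; rewrite mem0v.
case: (boolP (v \in _)) => vp; last by rewrite mul0r subr0 mul1r => /eqP; lra.
have p0 : p != 0.
  by apply: contraNneq v0 => p0; move: vp; rewrite p0 => /vlineP[s ->]; rewrite scaler0.
by split=> //; have := vline_sym v0 vp; apply: subvP; rewrite -memvE.
Qed.

(* A generator through a point of weight o carries no other point of nonzero
   weight, so it is contained in H. *)
Lemma perp_unit_point H p : (forall x, sing x -> hweight w x = (x \in H)) ->
    sing p -> w p = o ->
  (forall z, sing z -> bil z p = 0 -> z \in H) /\
  (forall z, sing z -> bil z p = 0 -> w z = o -> p \in <[z]>%VS).
Proof.
move=> XH sp wp; have [u0 ut to o0] := weight_order R F k_gt1.
have p0 : p != 0 by apply: contraTneq o0 => p0; rewrite -wp p0 w0 ltxx.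
(* The value o occurs only in the point alternative, so [p], and [z] if its weight is nonzero, lie
   on the point [<[x]>]. *)
have AB z : sing z -> bil z p = 0 -> exists2 x : V, (z \in <[x]>%VS) || (w z == 0)
    & p \in <[x]>%VS.
  move=> sz zp; have [M [gM zM pM]] := orthogonal_generator sz sp zp.
  case: (wM gM) => [[x xE]|[U [x [xU dM xE]]]]; last first.
    have := xE p pM; rewrite wp /affine_weight.
    by case: (p \in U); case: (p \in _); rewrite ?mul0r ?mul1r ?subr0 => E; lra.
  exists x; first by rewrite (xE z zM) /point_weight /through;
    case: (z \in _); rewrite ?andbF ?mul0r ?eqxx ?orbT.
  have := xE p pM; rewrite wp /point_weight /through.
  by case: (p \in _); rewrite ?andbF ?mul0r // => E; lra.
split=> z sz zp.
  have [M [gM zM pM]] := orthogonal_generator sz sp zp.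
  have : hweight w z; last by rewrite XH.
  case: (wM gM) => [[x xE]|[U [x [xU dM xE]]]]; first exact: point_weight_hweight (xE z zM).
  have := xE p pM; rewrite wp /affine_weight.
  by case: (p \in U); case: (p \in _); rewrite ?mul0r ?mul1r ?subr0 => E; lra.
move=> wz; have [x] := AB z sz zp; rewrite wz (gt_eqF o0) orbF => zx px.
have z0 : z != 0 by apply: contraTneq o0 => z0; rewrite -wz z0 w0 ltxx.
by have := vline_sym z0 zx; move: px => /vlineP[s ->]; apply: rpredZ.
Qed.

(** Three descriptions of [~~ f], all with the points of weight t - o: if some [x] has weight o, the
    perp of [x] has the same singular vectors as [H] and goes with [x] removed; otherwise [H] is
    used as it is if nondegenerate, and rewritten if degenerate. *)
Lemma polar_trivial_hyperplane_case p : sing p -> w p = t - o ->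
  polar_trivial phi (isotropic_spaces phi k) f.
Proof.
move=> sp wp; have [H [dH XH]] := hweight_hyperplane sp wp.
have [u0 ut to o0] := weight_order R F k_gt1.
have pX := not_hweight k_gt1 (or_intror wp); have pH : p \notin H by rewrite -XH.
have to0 : t - o != 0 by rewrite lt_eqF //; lra.
pose S := weight_points (t - o).
have SI : S \subset isotropic_points phi by apply/subsetP => x; rewrite inE => /andP[].
have set0E (P : {vspace V} -> bool) : [exists x in (set0 : {set {vspace V}}), P x] = false.
  by apply/existsP => -[x]; rewrite inE.
have set1E (x : {vspace V}) (P : {vspace V} -> bool) : [exists y in [set x], P y] = P x.
  apply/existsP/idP => [[y /andP[]]|Px]; first by rewrite inE => /eqP ->.
  by exists x; rewrite inE eqxx.
have perp_sub K (y : {vspace V}) : isotropic phi K -> (y <= K)%VS -> (K <= perp phi y)%VS.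
  move=> Ki /subvP yK; apply/subvP => x xK; apply/mem_perpP => v /yK vK.
  exact: isotropic_bil Ki xK vK.
have noneg K : isotropic phi K -> (K <= H)%VS ->
    [exists v, (v \in K) && (w v == t - o)] = false.
  move=> Ki KH; apply/existsP => -[v /andP[vK /eqP wv]].
  have := not_hweight k_gt1 (or_intror wv).
  by rewrite XH ?(isotropic_sing Ki) // (subvP KH).
have [/existsP[x /andP[sx /eqP wx]]|nounit] := boolP [exists x, sing x && (w x == o)].
  have [perpH unitx] := perp_unit_point XH sx wx.
  have x0 : x != 0 by apply: contraTneq o0 => x0; rewrite -wx x0 w0 ltxx.
  (* Here [geometric_hyperplane_maximal] is applied to the perp of [x] as hyperplane and to
     membership in [H] as [X], with [p] as the singular vector outside [H]. *)
  have Hperp y : sing y -> y \in H -> y \in perp phi <[x]>.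
    move=> sy yH.
    have [r nE] : exists r, n.+1 = r.+2 by exists n.-1; move: kn; case: (n).
    have PV' : polar_on phi fullv r.+2 by rewrite -nE.
    apply: (@geometric_hyperplane_maximal _ _ _ _ phiP (fun v => v \in H) _ _ r _ p) => //.
    - by move=> s v _; apply: rpredZ.
    - by move=> v v' _ _ _; apply: rpredD.
    - move=> z v; rewrite mem_perp1 => zx; exists (bil v x / bil z x).
      by rewrite mem_perp1 bilBl bilZl divfK // subrr.
    - by move=> z; rewrite mem_perp1 => /eqP zx sz; apply: perpH.
    by apply/negP.
  exists S, set0, [set <[x]>%VS]; split=> //.
  - by move=> y; rewrite inE.
  - by rewrite sub1set inE (isotropic_line phiP sx) dim_line // eqxx.
  right=> K; rewrite inE => /andP[Ki /eqP dK].
  rewrite (f_hyperplane XH Ki dK) exists_weight_point // set0E set1E /= /pointf /hyperf.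
  have -> : (K <= perp phi <[x]>)%VS = (K <= H)%VS.
    apply/subvP/subvP => KH v vK; have sv := isotropic_sing Ki vK.
      by apply: perpH => //; apply/eqP; rewrite -mem_perp1 KH.
    by apply: Hperp => //; apply: KH.
  case: (boolP (K <= H)%VS) => KH /=; last by rewrite orbF.
  rewrite noneg //= negbK; apply/existsP/idP => [[v /andP[vK /eqP wv]]|xK].
    have sv := isotropic_sing Ki vK.
    have vx : bil v x = 0 by apply/eqP; rewrite -mem_perp1 Hperp // (subvP KH).
    rewrite -memvE; have := unitx v sv vx wv; apply: subvP; by rewrite -memvE.
  by exists x; rewrite memvE xK wx eqxx.
have nounitK K : isotropic phi K -> [exists v, (v \in K) && (w v == o)] = false.
  move=> Ki; apply: contraNF nounit => /existsP[v /andP[vK wv]].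
  by apply/existsP; exists v; rewrite (isotropic_sing Ki vK).
have fH K : isotropic phi K -> \dim K = k ->
    f K = ~~ ([exists v, (v \in K) && (w v == t - o)] || (K <= H)%VS).
  move=> Ki dK; rewrite (f_hyperplane XH Ki dK) nounitK //.
  by case: (boolP (K <= H)%VS) => KH; rewrite ?orbT ?orbF.
have HH : H \in hyperplanes V by rewrite inE dH dimvf /dim /= mul1n.
have [deg|ndeg] := boolP (degenerate_hyperplane phi H); last first.
  exists S, [set H], set0; split=> //; last 1 first.
  - right=> K; rewrite inE => /andP[Ki /eqP dK].
    by rewrite fH // exists_weight_point // set0E set1E orbF.
  - by move=> y; rewrite inE => /eqP ->; rewrite /nondegenerate_hyperplane HH.
  exact: sub0set.
have /andP[_ /existsP[y /andP[yI /eqP HE]]] := deg.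
(* An isotropic space through [y] lies in [H], the perp of [y], so H^+ equals y^+ \/ (H^+ /\
   y^-). *)
exists (y |: S), set0, [set y]; split.
- by rewrite subUset sub1set yI.
- by move=> z; rewrite inE.
- by rewrite sub1set.
right=> K; rewrite inE => /andP[Ki /eqP dK]; rewrite fH // set0E set1E /=; congr (~~ _).
rewrite -exists_weight_point // /hyperf -HE.
apply/orP/orP => [[/existsP[z /andP[zS zK]]|KH]|[/existsP[z /andP[]]|/andP[KH _]]].
- by left; apply/existsP; exists z; rewrite inE zS orbT.
- have [yK|yK] := boolP (pointf y K); last by right; rewrite KH.
  by left; apply/existsP; exists y; rewrite !inE eqxx.
- rewrite in_setU1 => /orP[/eqP ->|zS] zK; last by left; apply/existsP; exists z; rewrite zS.
  by right; rewrite HE; apply: perp_sub.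
by right.
Qed.

Lemma polar_trivial_of_zero_type : polar_trivial phi (isotropic_spaces phi k) f.
Proof.
have [/existsP[v /andP[sv /eqP wv]]|wn] := boolP [exists v, sing v && (w v == t - o)].
  exact: polar_trivial_hyperplane_case sv wv.
apply: polar_trivial_nonneg => v sv; apply: contraNneq wn => wv.
by apply/existsP; exists v; rewrite sv wv eqxx.
Qed.

End Assembly.

(** * Conclusion *)

Lemma polar_rank_on (F : finFieldType) d e (phi : classical_form F d) :
  form_of_type e phi -> polar_on phi fullv (polar_rank phi).
Proof.
move=> phiP; split=> [v _ sv vr|].
  by apply: (sing_radical phiP sv) => u; apply: vr; apply: memvf.
have i0 : isotropic phi 0%VS.
  by apply: isotropicS (sub0v _) (isotropic_line phiP (sing0 phiP)).
have iso_gt0 : (0 < #|[pred U | isotropic phi U]|)%N by apply/card_gt0P; exists 0%VS.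
have [M Mi dM] := eq_bigmax_cond (fun U : {vspace _} => \dim U) iso_gt0.
by exists M; split; [exact: Mi | exact: subvf | rewrite -dM].
Qed.

Lemma polar_trivial_compl (F : finFieldType) d (phi : classical_form F d)
    (D : {set {vspace 'rV[F]_d}}) f :
  polar_trivial phi D (fun K => ~~ f K) -> polar_trivial phi D f.
Proof.
move=> [S [N [T [SI NH TI fE]]]]; exists S, N, T; split=> //.
by case: fE => fE; [right | left] => K KD; rewrite -[LHS]negbK fE // negbK.
Qed.

Theorem theorem5p9 (R : realType) (F : finFieldType) (e : polar_type)
    (n k : nat) (hk : (2 <= k)%N) (hnk : (2 <= n - k)%N) :
  all_polar_trivial R F e n k ->
  all_grassmann_trivial R F n.+1 k ->
  all_polar_trivial R F e n.+1 k.
Proof.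
move=> polar_n grass_n phi [phiP rk] f deg.
have kn : (k.+2 <= n)%N by move: hnk; rewrite ltn_subRL addnC.
have k_gt0 : (0 < k)%N := ltnW hk.
have PV := polar_rank_on phiP; rewrite rk in PV.
have dimE : ambient_dim e n.+1 = (ambient_dim e n).+2 by case: (e).
have [w [w0 wZ wE]] : exists w, [/\ w 0 = 0, homogeneous (R := R) w & weighs k phi w f].
  have [|||w [w0 wZ wE]] := degree1_weights k_gt0 _ _ _ deg.
  - by move=> K; rewrite inE => /andP[_ /eqP].
  - by move=> K; rewrite inE => /andP[_ /eqP].
  - move=> K; rewrite inE => /andP[Ki _] p dp pK.
    by rewrite inE dp (isotropicS pK Ki).
  by exists w; split=> // K Ki dK; apply: wE; rewrite inE Ki dK eqxx.
have shape M : generator n phi M -> zero_shape k f M \/ zero_shape k (fun K => ~~ f K) M.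
  move=> [Mi dM]; have [emb [emb_inj iM]] := exists_embedding dM.
  apply: (zero_shape_grassmann emb_inj grass_n iM w0) => K KM dK.
  by apply: wE => //; apply: isotropicS Mi.
(* Stated for any weighted function, since it serves both [f] and its complement. *)
have IH g (wg : 'rV[F]_(ambient_dim e n.+1) -> R) : wg 0 = 0 -> weighs k phi wg g ->
    forall a b, sing phi a -> sing phi b -> bil phi a b != 0 ->
  polar_trivial_on k phi g (hperp phi fullv a b).
  move=> wg0 wgE a b sa sb ab.
  have PW := polar_hperp phiP PV (memvf a) (memvf b) sa sb ab.
  have dW : \dim (hperp phi fullv a b) = ambient_dim e n.
    by apply/eqP; rewrite -2!eqSS (dim_hperp phiP) // dimE.
  have [emb [emb_inj iW]] := exists_embedding dW; rewrite -iW in PW *.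
  apply: (polar_trivial_pullback emb_inj wg0 wgE).
  apply: (polar_n (pullback_form phi emb)).
  split; first exact: pullback_of_type PW.
  apply: (pullback_rank emb_inj PW) => M Mi MW.
  (* Adding [a] to an isotropic space of the complement gives an isotropic space of one more
     dimension, so the rank there is at most [n]. *)
  have aM : a \notin M.
    apply/negP => /(subvP MW); rewrite iW mem_hperp (negbTE ab).
    by rewrite !andbF.
  rewrite -ltnS -(dim_add_line_notin aM); apply: leq_trans (eq_leq rk).
  apply: (@leq_bigmax_cond _ _ (fun U : {vspace _} => \dim U)).
  apply: (isotropic_add_line phiP) => // v /(subvP MW).
  by rewrite iW mem_hperp => /and3P[_ /eqP].
(* Either [f] or its complement has zero type on all generators, and triviality is invariant under
   complements. *)
case: (zero_type_uniform phiP hk kn PV w0 wZ wE shape) => wM.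
  exact: (polar_trivial_of_zero_type phiP hk kn PV w0 wZ wE wM (IH _ _ w0 wE)).
have c0 : compl_weight k w 0 = 0 by rewrite /compl_weight eqxx mul0r w0 subrr.
have cE := compl_weighs hk wE.
apply: polar_trivial_compl.
exact: (polar_trivial_of_zero_type phiP hk kn PV c0 (compl_weight_homogeneous k wZ) cE wM
  (IH _ _ c0 cE)).
Qed.
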